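(* For each positive integer $n$, the subvarieties of $\mathsf{DLP}$ that are properly $n$-periodic comprise exactly the interval \[ \Big[\bigvee_{q\in P}\mathbb{V}(\mathbf{F}_q(\mathbb{Z})),\ \mathsf{LP}_n\Big] \] of the subvariety lattice of $\mathsf{DLP}$, where $P=\{p_1^{k_1},\dots,p_l^{k_l}\}$ is the set of all maximal prime powers that divide $n$, i.e., $p_1,\dots,p_l$ are distinct primes such that $n=p_1^{k_1}\cdots p_l^{k_l}$. If $n$ is a prime power, this interval is $[\mathbb{V}(\mathbf{F}_n(\mathbb{Z})),\mathsf{LP}_n]$.
   Context: An $\ell$-pregroup is an algebra $(A,\wedge,\vee,\cdot,1,{}^{\ell},{}^{r})$ such that $(A,\wedge,\vee)$ is a lattice, $(A,\cdot,1)$ is a monoid, multiplication is order-preserving in both arguments, and $a^{\ell}a\le 1\le aa^{\ell}$ and $aa^{r}\le 1\le a^{r}a$ for all $a\in A$. It is distributive if its lattice reduct is distributive; $\mathsf{DLP}$ is the variety of distributive $\ell$-pregroups. Write $x^{\ell^k}$, $x^{r^k}$ for the $k$-fold application of ${}^\ell$, ${}^r$. An $\ell$-pregroup is $n$-periodic if it satisfies $x^{\ell^n}\approx x^{r^n}$; $\mathsf{LP}_n$ is the variety of $n$-periodic $\ell$-pregroups (it is known that $\mathsf{LP}_n\subseteq\mathsf{DLP}$). A variety of $\ell$-pregroups is $n$-periodic if all its members are, and properly $n$-periodic if it is $n$-periodic but not $m$-periodic for any positive integer $m<n$. $\mathbf{F}(\mathbb{Z})$ is the $\ell$-pregroup of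 all order-preserving maps $f\colon\mathbb{Z}\to\mathbb{Z}$ such that $f^{-1}[\{x\}]$ is finite for every $x\in\mathbb{Z}$, with composition as multiplication, the identity map as $1$, the pointwise order, and $f^{\ell}(q)=\min\{p: q\le f(p)\}$, $f^{r}(q)=\max\{p: f(p)\le q\}$. $\mathbf{F}_n(\mathbb{Z})$ is the subalgebra of all $f$ with $f^{\ell^n}=f^{r^n}$; equivalently, all $f\in \mathbf{F}(\mathbb{Z})$ with $f(x+n)=f(x)+n$ for all $x\in\mathbb{Z}$. $\mathbb{V}(\mathcal{K})$ denotes the variety generated by $\mathcal{K}$. Joins are taken in the subvariety lattice of $\mathsf{DLP}$ (the empty join, for $n=1$, is the trivial variety); the prime-power exponents $k_i$ are positive, and a prime power means $p^k$ with $p$ prime and $k\ge 1$. *)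

(* Defs.v *)
From HB Require Import structures.
From mathcomp Require Import all_boot all_order all_algebra zify.
From mathcomp Require Import boolp classical_sets cardinality.
Set Implicit Arguments.
Unset Strict Implicit.
Unset Printing Implicit Defensive.
Import Order.TTheory GRing.Theory Num.Theory.

Local Open Scope group_scope.
Local Open Scope order_scope.

(* Displays only tag the order notations: all algebras use the same one. *)
Fact lp_display : Order.disp_t. Proof. exact: Order.Disp tt tt. Qed.

HB.mixin Record isLPregroup d A of Order.Lattice d A & Monoid A := {
  ladj : A -> A;
  radj : A -> A;
  lp_mul2l : forall z x y : A, x <= y -> z * x <= z * y;
  lp_mul2r : forall z x y : A, x <= y -> x * z <= y * z;
  ladjM_le1 : forall x : A, ladj x * x <= 1;
  Mladj_ge1 : forall x : A, (1 : A) <= x * ladj x;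
  Mradj_le1 : forall x : A, x * radj x <= 1;
  radjM_ge1 : forall x : A, (1 : A) <= radj x * x;
}.

#[short(type="lpregroupType")]
HB.structure Definition LPregroup d :=
  {A of Order.Lattice d A & Monoid A & isLPregroup d A}.

Definition n_periodic d (A : lpregroupType d) (n : nat) : Prop :=
  forall x : A, iter n ladj x = iter n radj x.

Section LPregroupTheory.
Context {d : Order.disp_t} {A : lpregroupType d}.
Implicit Types x y z : A.

Lemma ladj_unique x y : y * x <= 1 -> (1 : A) <= x * y -> y = ladj x.
Proof.
move=> h1 h2; apply/eqP; rewrite eq_le; apply/andP; split.
  rewrite -[leLHS]mulg1 (le_trans (lp_mul2l y _ _ (Mladj_ge1 x)))//.
  by rewrite mulgA -[leRHS]mul1g lp_mul2r.
rewrite -[leLHS]mulg1 (le_trans (lp_mul2l (ladj x) _ _ h2))//.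
by rewrite mulgA -[leRHS]mul1g lp_mul2r ?ladjM_le1.
Qed.

Lemma radj_unique x y : x * y <= 1 -> (1 : A) <= y * x -> y = radj x.
Proof.
move=> h1 h2; apply/eqP; rewrite eq_le; apply/andP; split.
  rewrite -[leLHS]mul1g (le_trans (lp_mul2r y _ _ (radjM_ge1 x)))//.
  by rewrite -mulgA -[leRHS]mulg1 lp_mul2l.
rewrite -[leLHS]mul1g (le_trans (lp_mul2r (radj x) _ _ h2))//.
by rewrite -mulgA -[leRHS]mulg1 lp_mul2l ?Mradj_le1.
Qed.

Lemma ladjK : cancel (@ladj d A) radj.
Proof. by move=> x; rewrite -(@radj_unique (ladj x) x) ?ladjM_le1 ?Mladj_ge1. Qed.

Lemma radjK : cancel (@radj d A) ladj.
Proof. by move=> x; rewrite -(@ladj_unique (radj x) x) ?Mradj_le1 ?radjM_ge1. Qed.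

Lemma ladj1 : ladj (1 : A) = 1.
Proof. by rewrite -(@ladj_unique 1 1) ?mulg1. Qed.

Lemma ladjM x y : ladj (x * y) = ladj y * ladj x.
Proof.
symmetry; apply: ladj_unique.
  rewrite mulgA -[_ * _ * x]mulgA.
  apply: le_trans (ladjM_le1 y); apply: lp_mul2r.
  by rewrite -[leRHS]mulg1; apply: lp_mul2l; apply: ladjM_le1.
rewrite mulgA -[x * y * _]mulgA; apply: (le_trans (Mladj_ge1 x)).
apply: lp_mul2r; rewrite -[leLHS]mulg1; apply: lp_mul2l; exact: Mladj_ge1.
Qed.

Lemma ladj_anti x y : x <= y -> ladj y <= ladj x.
Proof.
move=> xy; rewrite -[leLHS]mulg1 (le_trans (lp_mul2l _ _ _ (Mladj_ge1 x)))//.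
rewrite mulgA -[leRHS]mul1g lp_mul2r//.
exact: le_trans (lp_mul2l _ _ _ xy) (ladjM_le1 y).
Qed.

Lemma radj_anti x y : x <= y -> radj y <= radj x.
Proof.
move=> xy; rewrite -[leLHS]mul1g (le_trans (lp_mul2r _ _ _ (radjM_ge1 x)))//.
rewrite -mulgA -[leRHS]mulg1 lp_mul2l//.
exact: le_trans (lp_mul2r _ _ _ xy) (Mradj_le1 y).
Qed.

Lemma ladj_le x y : (ladj x <= ladj y) = (y <= x).
Proof.
by apply/idP/idP => [/radj_anti|/ladj_anti//]; rewrite !ladjK.
Qed.

Lemma ladjI x y : ladj (Order.meet x y) = Order.join (ladj x) (ladj y).
Proof.
apply/eqP; rewrite eq_le leUx !ladj_le leIl leIr !andbT.
by rewrite -[Order.join _ _]radjK ladj_le lexI -!(ladj_le _ (radj _)) radjK leUl leUr.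
Qed.

Lemma ladjU x y : ladj (Order.join x y) = Order.meet (ladj x) (ladj y).
Proof.
apply/eqP; rewrite eq_le lexI !ladj_le leUl leUr /=.
by rewrite -[Order.meet _ _]radjK ladj_le leUx -!(ladj_le (radj _)) radjK leIl leIr.
Qed.

Lemma iter_ladj2P n x :
  iter n ladj x = iter n radj x <-> iter n.*2 ladj x = x.
Proof.
have lK k y : iter k ladj (iter k radj y) = y.
  by elim: k y => // k IH y; rewrite iterSr /= radjK IH.
have rK k y : iter k radj (iter k ladj y) = y.
  by elim: k y => // k IH y; rewrite iterSr /= ladjK IH.
rewrite -addnn iterD; split=> [->|]; first exact: lK.
by move=> /(congr1 (iter n radj)); rewrite rK.
Qed.

Lemma iter_ladj2M n x y :
  iter n.*2 ladj (x * y) = iter n.*2 ladj x * iter n.*2 ladj y.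
Proof. by elim: n => //= n ->; rewrite !ladjM. Qed.

Lemma iter_ladj2I n x y :
  iter n.*2 ladj (Order.meet x y)
  = Order.meet (iter n.*2 ladj x) (iter n.*2 ladj y).
Proof. by elim: n => //= n ->; rewrite ladjI ladjU. Qed.

Lemma iter_ladj2U n x y :
  iter n.*2 ladj (Order.join x y)
  = Order.join (iter n.*2 ladj x) (iter n.*2 ladj y).
Proof. by elim: n => //= n ->; rewrite ladjU ladjI. Qed.

End LPregroupTheory.

Section PeriodicSubalgebra.
Context {d : Order.disp_t} (A : lpregroupType d) (n : nat).

Definition periodic_elt : {pred A} :=
  fun x => iter n ladj x == iter n radj x.

Record periodic_sub :=
  PeriodicSub { periodic_val :> A; periodic_valP : periodic_val \in periodic_elt }.

HB.instance Definition _ := [isSub for periodic_val].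
HB.instance Definition _ := [Choice of periodic_sub by <:].

Lemma periodic_eltP x : reflect (iter n.*2 ladj x = x) (x \in periodic_elt).
Proof.
by apply: (iffP idP) => [/eqP /iter_ladj2P //|/iter_ladj2P /eqP].
Qed.

Fact periodic_umagma_closed : umagma_closed periodic_elt.
Proof.
split; first by apply/periodic_eltP; elim: n => //= m ->; rewrite !ladj1.
by move=> x y /periodic_eltP hx /periodic_eltP hy; apply/periodic_eltP;
  rewrite iter_ladj2M hx hy.
Qed.
HB.instance Definition _ :=
  SubChoice_isSubMonoid.Build A periodic_elt periodic_sub periodic_umagma_closed.

Fact periodic_meet_closed : {in periodic_elt &, forall x y, Order.meet x y \in periodic_elt}.
Proof.
by move=> x y /periodic_eltP hx /periodic_eltP hy; apply/periodic_eltP;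
  rewrite iter_ladj2I hx hy.
Qed.
Fact periodic_join_closed : {in periodic_elt &, forall x y, Order.join x y \in periodic_elt}.
Proof.
by move=> x y /periodic_eltP hx /periodic_eltP hy; apply/periodic_eltP;
  rewrite iter_ladj2U hx hy.
Qed.
HB.instance Definition _ := Order.isLatticeClosed.Build d A periodic_elt
  periodic_meet_closed periodic_join_closed.
HB.instance Definition _ := [SubChoice_isSubLattice of periodic_sub by <: with d].

Fact periodic_ladj_closed x : x \in periodic_elt -> ladj x \in periodic_elt.
Proof.
by move=> /periodic_eltP hx; apply/periodic_eltP; rewrite -iterSr iterS hx.
Qed.
Fact periodic_radj_closed x : x \in periodic_elt -> radj x \in periodic_elt.
Proof.
move=> /periodic_eltP hx; apply/periodic_eltP; apply: (can_inj ladjK).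
by rewrite -iterS iterSr radjK.
Qed.

Definition periodic_ladj (x : periodic_sub) : periodic_sub :=
  PeriodicSub (periodic_ladj_closed (periodic_valP x)).
Definition periodic_radj (x : periodic_sub) : periodic_sub :=
  PeriodicSub (periodic_radj_closed (periodic_valP x)).

Fact periodic_mul2l (z x y : periodic_sub) : x <= y -> z * x <= z * y.
Proof. exact: lp_mul2l. Qed.
Fact periodic_mul2r (z x y : periodic_sub) : x <= y -> x * z <= y * z.
Proof. exact: lp_mul2r. Qed.
Fact periodic_ladjM (x : periodic_sub) : periodic_ladj x * x <= 1.
Proof. exact: ladjM_le1. Qed.
Fact periodic_Mladj (x : periodic_sub) : (1 : periodic_sub) <= x * periodic_ladj x.
Proof. exact: Mladj_ge1. Qed.
Fact periodic_Mradj (x : periodic_sub) : x * periodic_radj x <= 1.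
Proof. exact: Mradj_le1. Qed.
Fact periodic_radjM (x : periodic_sub) : (1 : periodic_sub) <= periodic_radj x * x.
Proof. exact: radjM_ge1. Qed.
HB.instance Definition _ := isLPregroup.Build d periodic_sub
  periodic_mul2l periodic_mul2r
  periodic_ladjM periodic_Mladj periodic_Mradj periodic_radjM.

End PeriodicSubalgebra.

Local Open Scope classical_set_scope.

Definition fz : {pred int -> int} := fun f =>
  `[< {homo f : x y / x <= y} /\ forall x, finite_set (f @^-1` [set x]) >].

Record FZ := MkFZ { fz_val :> int -> int; fz_valP : fz_val \in fz }.

Section FZTheory.
Implicit Types (f g : int -> int) (p q x y : int).
Local Open Scope ring_scope.

Let homo_up_unbounded f q : {homo f : x y / x <= y} ->
  (forall x, finite_set (f @^-1` [set x])) -> exists p, q <= f p.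
Proof.
move=> fh ff; apply: contrapT => /forallNP h.
have lt p : f p < q by rewrite ltNge; apply/negP.
have sub : [set: nat] `<=`
   \bigcup_(i in `I_(`|(q - f 0)%R|%N)) [set m : nat | f m%:Z = f 0 + i%:Z].
  move=> m _; have ltm := lt m%:Z; have lem : f 0 <= f m%:Z by apply: fh; lia.
  by exists `|(f m%:Z - f 0)%R|%N => /=; lia.
apply: infinite_nat; apply: sub_finite_set sub _.
apply: bigcup_finite => [|i _]; first exact: finite_II.
apply: (@finite_preimage _ _ (f @^-1` [set f 0 + i%:Z]) Posz) => //.
by move=> a b _ _ [].
Qed.

Let homo_dn_unbounded f q : {homo f : x y / x <= y} ->
  (forall x, finite_set (f @^-1` [set x])) -> exists p, f p <= q.
Proof.
move=> fh ff.
have [||p hp] := @homo_up_unbounded (fun x => - f (- x)) (- q).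
- by move=> x y xy; have := fh (- y) (- x); lia.
- move=> x; have -> : (fun x => - f (- x)) @^-1` [set x]
     = -%R @^-1` (f @^-1` [set - x]).
    by apply/seteqP; split => z /=; lia.
  by apply: finite_preimage => // a b _ _; lia.
by exists (- p); lia.
Qed.

Lemma fzP f : reflect
  [/\ {homo f : x y / x <= y}, forall q, exists p, q <= f p
    & forall q, exists p, f p <= q] (f \in fz).
Proof.
apply: (iffP (asboolP _)) => [[fh ff]|[fh fu fd]].
  by split => // q; [exact: homo_up_unbounded|exact: homo_dn_unbounded].
split=> // x; have [a ha] := fd (x - 1); have [b hb] := fu (x + 1).
apply: (@sub_finite_set _ _ ((fun i : nat => a + i%:Z) @` `I_(`|(b - a)%R|%N))).
  move=> z /= fzx; have h1 : a < z.
    by rewrite ltNge; apply/negP => /fh; lia.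
  have h2 : z < b by rewrite ltNge; apply/negP => /fh; lia.
  by exists `|(z - a)%R|%N; lia.
by apply: finite_image; exact: finite_II.
Qed.

Fact fz_homo (f : FZ) : {homo f : x y / x <= y}.
Proof. by have /fzP[] := fz_valP f. Qed.

Fact fz_unbounded_up (f : FZ) q : exists p, q <= f p.
Proof. by have /fzP[] := fz_valP f. Qed.

Fact fz_unbounded_dn (f : FZ) q : exists p, f p <= q.
Proof. by have /fzP[] := fz_valP f. Qed.

End FZTheory.

HB.instance Definition _ := [isSub for fz_val].
HB.instance Definition _ := [Choice of FZ by <:].

Fact fz_meet_closed : {in fz &, forall f g, Order.meet f g \in fz}.
Proof.
move=> f g /fzP[fh fu fd] /fzP[gh gu gd]; apply/fzP; split => [x y xy|q|q].
- by rewrite !meetfE leI2 ?fh ?gh.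
- have [a ha] := fu q; have [b hb] := gu q; exists (Order.max a b).
  rewrite !meetfE lexI.
  by rewrite (le_trans ha) ?(le_trans hb) ?fh ?gh// le_max lexx ?orbT.
- have [a ha] := fd q; exists a.
  by rewrite !meetfE (le_trans _ ha)// leIl.
Qed.

Fact fz_join_closed : {in fz &, forall f g, Order.join f g \in fz}.
Proof.
move=> f g /fzP[fh fu fd] /fzP[gh gu gd]; apply/fzP; split => [x y xy|q|q].
- by rewrite !joinfE leU2 ?fh ?gh.
- have [a ha] := fu q; exists a.
  by rewrite !joinfE (le_trans ha)// leUl.
- have [a ha] := fd q; have [b hb] := gd q; exists (Order.min a b).
  rewrite !joinfE leUx.
  by rewrite (le_trans _ ha) ?(le_trans _ hb) ?fh ?gh// ge_min lexx ?orbT.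
Qed.

HB.instance Definition _ := Order.isLatticeClosed.Build _ (int -> int) fz
  fz_meet_closed fz_join_closed.
HB.instance Definition _ :=
  [SubChoice_isSubLattice of FZ by <: with lp_display].

Fact fz_id : id \in fz.
Proof. by apply/fzP; split => // q; exists q. Qed.
Fact fz_comp (f g : FZ) : (f : int -> int) \o g \in fz.
Proof.
apply/fzP; split => [x y xy|q|q] /=; first by rewrite !fz_homo.
- have [a ha] := fz_unbounded_up f q; have [b hb] := fz_unbounded_up g a.
  by exists b; rewrite (le_trans ha)// fz_homo.
- have [a ha] := fz_unbounded_dn f q; have [b hb] := fz_unbounded_dn g a.
  by exists b; rewrite (le_trans _ ha)// fz_homo.
Qed.

Definition FZ_one : FZ := MkFZ fz_id.
Definition FZ_mul (f g : FZ) : FZ := MkFZ (fz_comp f g).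

Fact FZ_mulA : associative FZ_mul. Proof. by move=> f g h; apply: val_inj. Qed.
Fact FZ_mul1 : left_id FZ_one FZ_mul. Proof. by move=> f; apply: val_inj. Qed.
Fact FZ_1mul : right_id FZ_one FZ_mul. Proof. by move=> f; apply: val_inj. Qed.
HB.instance Definition _ :=
  isMonoid.Build FZ FZ_mulA FZ_mul1 FZ_1mul.

(* [xget 0 S] is the element of the singleton S (the minimum, resp. maximum,
   exists by the unboundedness of f), so the default 0 is never used. *)
Definition ladj_fun (f : int -> int) (q : int) : int :=
  xget 0%R [set p | q <= f p /\ forall p', q <= f p' -> p <= p'].
Definition radj_fun (f : int -> int) (q : int) : int :=
  xget 0%R [set p | f p <= q /\ forall p', f p' <= q -> p' <= p].

Fact ladj_funP (f : FZ) (q p : int) : (ladj_fun f q <= p) = (q <= f p).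
Proof.
suff [h1 h2] : q <= f (ladj_fun f q) /\
    forall p', q <= f p' -> ladj_fun f q <= p'.
  by apply/idP/idP => [/(fz_homo f)|/h2 //]; exact: le_trans.
rewrite /ladj_fun; case: xgetP => [p0 -> //|hn]; exfalso.
have [a ha] := fz_unbounded_dn f (q - 1)%R; have [b hb] := fz_unbounded_up f q.
have lta p' : q <= f p' -> a < p'.
  by move=> h; rewrite ltNge; apply/negP => /(fz_homo f); lia.
have ex : exists m : nat, q <= f (a + m%:Z)%R.
  exists `|(b - a)%R|%N; have := lta _ hb => ab.
  by have -> : (a + Posz (absz (b - a)) = b)%R by lia.
case: (ex_minnP ex) => m hm mmin; apply: (hn (a + m%:Z)%R) => /=; split => // p' hp'.
have := lta _ hp' => ap'; have := mmin `|(p' - a)%R|%N.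
have -> : (a + Posz (absz (p' - a)) = p')%R by lia.
by move=> /(_ hp'); lia.
Qed.

Fact radj_funP (f : FZ) (q p : int) : (p <= radj_fun f q) = (f p <= q).
Proof.
suff [h1 h2] : f (radj_fun f q) <= q /\
    forall p', f p' <= q -> p' <= radj_fun f q.
  by apply/idP/idP => [/(fz_homo f) h|/h2 //]; exact: le_trans h h1.
rewrite /radj_fun; case: xgetP => [p0 -> //|hn]; exfalso.
have [a ha] := fz_unbounded_up f (q + 1)%R; have [b hb] := fz_unbounded_dn f q.
have lta p' : f p' <= q -> p' < a.
  by move=> h; rewrite ltNge; apply/negP => /(fz_homo f); lia.
have ex : exists m : nat, f (a - m%:Z)%R <= q.
  exists `|(a - b)%R|%N; have := lta _ hb => ab.
  by have -> : (a - Posz (absz (a - b)) = b)%R by lia.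
case: (ex_minnP ex) => m hm mmin; apply: (hn (a - m%:Z)%R) => /=; split => // p' hp'.
have := lta _ hp' => ap'; have := mmin `|(a - p')%R|%N.
have -> : (a - Posz (absz (a - p')) = p')%R by lia.
by move=> /(_ hp'); lia.
Qed.

Fact fz_ladj (f : FZ) : ladj_fun f \in fz.
Proof.
apply/fzP; split => [x y xy|q|q].
- by rewrite ladj_funP (le_trans xy)// -ladj_funP.
- exists (f q + 1)%R; rewrite leNgt; apply/negP => /ltW.
  by rewrite ladj_funP; lia.
- by exists (f q); rewrite ladj_funP.
Qed.

Fact fz_radj (f : FZ) : radj_fun f \in fz.
Proof.
apply/fzP; split => [x y xy|q|q].
- by rewrite radj_funP (le_trans _ xy)// -radj_funP.
- by exists (f q); rewrite radj_funP.
- exists (f q - 1)%R; rewrite leNgt; apply/negP => /ltW.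
  by rewrite radj_funP; lia.
Qed.

Definition FZ_ladj (f : FZ) : FZ := MkFZ (fz_ladj f).
Definition FZ_radj (f : FZ) : FZ := MkFZ (fz_radj f).

Fact FZ_leP (f g : FZ) : reflect (forall x : int, f x <= g x) (f <= g).
Proof. exact: asboolP. Qed.

Fact FZ_mul2l (h f g : FZ) : f <= g -> h * f <= h * g.
Proof. by move=> /FZ_leP fg; apply/FZ_leP => x; exact: fz_homo. Qed.
Fact FZ_mul2r (h f g : FZ) : f <= g -> f * h <= g * h.
Proof. by move=> /FZ_leP fg; apply/FZ_leP => x; exact: fg. Qed.
Fact FZ_ladjM (f : FZ) : FZ_ladj f * f <= 1.
Proof. by apply/FZ_leP => x; rewrite [leLHS]/= ladj_funP. Qed.
Fact FZ_Mladj (f : FZ) : (1 : FZ) <= f * FZ_ladj f.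
Proof. by apply/FZ_leP => x; rewrite [leRHS]/= -ladj_funP. Qed.
Fact FZ_Mradj (f : FZ) : f * FZ_radj f <= 1.
Proof. by apply/FZ_leP => x; rewrite [leLHS]/= -radj_funP. Qed.
Fact FZ_radjM (f : FZ) : (1 : FZ) <= FZ_radj f * f.
Proof. by apply/FZ_leP => x; rewrite [leRHS]/= radj_funP. Qed.
HB.instance Definition _ := isLPregroup.Build lp_display FZ
  FZ_mul2l FZ_mul2r FZ_ladjM FZ_Mladj FZ_Mradj FZ_radjM.

Notation lpregroup := (lpregroupType lp_display).

Definition FnZ (n : nat) : lpregroup := @periodic_sub lp_display FZ n.

Inductive lpterm :=
  | TVar of nat
  | TMeet of lpterm & lpterm
  | TJoin of lpterm & lpterm
  | TMul of lpterm & lpterm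
  | TOne
  | TLadj of lpterm
  | TRadj of lpterm.

Fixpoint lpeval d (A : lpregroupType d) (v : nat -> A) (t : lpterm) : A :=
  match t with
  | TVar i => v i
  | TMeet s t => Order.meet (lpeval v s) (lpeval v t)
  | TJoin s t => Order.join (lpeval v s) (lpeval v t)
  | TMul s t => lpeval v s * lpeval v t
  | TOne => 1
  | TLadj t => ladj (lpeval v t)
  | TRadj t => radj (lpeval v t)
  end.

Definition satisfies d (A : lpregroupType d) (e : lpterm * lpterm) : Prop :=
  forall v : nat -> A, lpeval v e.1 = lpeval v e.2.

Definition models (E : set (lpterm * lpterm)) : set lpregroup :=
  [set A : lpregroup | forall e, E e -> satisfies A e].

Definition variety (V : set lpregroup) : Prop := exists E, V = models E.

Definition generated_variety (K : set lpregroup) : set lpregroup :=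
  \bigcap_(V in [set V | variety V /\ K `<=` V]) V.

Definition DLP : set lpregroup :=
  [set A : lpregroup | forall x y z : A,
     Order.meet x (Order.join y z) = Order.join (Order.meet x y) (Order.meet x z)].

Definition LP (n : nat) : set lpregroup := [set A : lpregroup | n_periodic A n].

Definition subvarieties (V : set lpregroup) : set (set lpregroup) :=
  [set W | variety W /\ W `<=` V].

(* The least upper bound of S in the complete lattice [subvarieties V]. *)
Definition variety_join (V : set lpregroup) (S : set (set lpregroup)) :
    set lpregroup :=
  \bigcap_(W in [set W | subvarieties V W /\ forall X, S X -> X `<=` W]) W.

Definition variety_interval (V L H : set lpregroup) : set (set lpregroup) :=
  [set W | [/\ subvarieties V W, L `<=` W & W `<=` H]].

Definition periodic_class (n : nat) (W : set lpregroup) : Prop :=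
  forall A : lpregroup, W A -> n_periodic A n.

Definition properly_periodic (n : nat) (W : set lpregroup) : Prop :=
  periodic_class n W /\
  forall m : nat, (0 < m < n)%N -> ~ periodic_class m W.

(* [prime_decomp n] lists the pairs (p_i, k_i) of the factorization of n. *)
Definition maximal_prime_powers (n : nat) : set nat :=
  [set (f.1 ^ f.2)%N | f in [set` prime_decomp n]].

(* Main.v *)
From HB Require Import structures.
Require Import Defs.
From mathcomp Require Import all_boot all_order all_algebra zify.
From mathcomp Require Import boolp classical_sets.

(** Being [m]-periodic says that the [m]-th power of the automorphism
    [x |-> ladj (ladj x)] (of the monoid and the lattice) is the identity.  On
    [FZ] this automorphism is conjugation by the translation of the integers,
    so the staircase [x |-> q * floor (x / q)] shows that [FnZ q] is
    [m]-periodic only if [q] divides [m].  Hence a variety that contains [FnZ q]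
    for every maximal prime power [q] of [n] is not [m]-periodic for [m < n]:
    this is one inclusion.

    For the other one, let [p] be a prime divisor of [n], [q] the corresponding
    maximal prime power, and let [A] be distributive and [n]-periodic but not
    [n / p]-periodic.  Every equation of [A] must be shown to hold in [FnZ q].

    The algebra [A] acts on chains: if [P] is a prime filter, the sets
    [{z | z * a \in P}] form a chain, because of the inequality
    [xa /\ yb <= xb \/ ya], and [P] can be chosen to separate any two elements
    ([chain_action_separation]).  On such a chain the adjoints of [a] act as
    lower and upper adjoints, and a covering pair [u < v] is mapped to the
    covering pair [a u < a'' v], where [a''] is the double left adjoint
    ([covers_act]).  So an integer-indexed sequence of successive covers (a
    [block]) is mapped by the iterated double adjoints of [a] to another block,
    and [n]-periodicity forces [a] itself to map the first block into the
    second one, acting there as a member of [FnZ n] ([block_transport]).  Blocks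
    exist wherever the action of [a''] differs from that of [a]
    ([block_of_shift]).

    Some [x] in [A] is moved by the [n / p]-th power of the automorphism, so it
    acts from a block to a block as a function [f] that does not commute with
    the translation by [n / p].  Then the closure operator onto the image of [f]
    or the one attached to its kernel does not commute either
    ([shift_eq_of_kernel_image]), and it acts on a single block.  The functions
    that [A] realizes on this block form a subalgebra of [FZ] containing a
    closure operator whose set [C] of fixed points is invariant under the
    translation by [n] but not by [n / p].  The intersection of the translates
    of [C] that contain [0] is the stabilizer of [C] in the integers, hence
    contained in the multiples of [q]; out of it one builds the closure operator
    onto the multiples of [q], then all staircases of width [q], and then all of
    [FnZ q] ([periodic_in_subalgebra]).  Thus [FnZ q] lies in the variety
    generated by [A]. *)

Set Implicit Arguments.
Unset Strict Implicit.
Unset Printing Implicit Defensive.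
Import Order.TTheory GRing.Theory Num.Theory.

Local Open Scope group_scope.
Local Open Scope order_scope.

(** * Iterated double adjoints *)
Section DoubleAdjoint.
Context {d : Order.disp_t} {A : lpregroupType d}.
Implicit Types (a b : A) (i j : int) (n k : nat).

(** Negative exponents use [radj], so that [dadj] is an action of the integers
    by automorphisms. *)
Definition dadj j a : A :=
  match j with
  | Posz k => iter k.*2 ladj a
  | Negz k => iter k.+1.*2 radj a
  end.

Lemma dadjS j a : dadj (j + 1)%R a = ladj (ladj (dadj j a)).
Proof.
case: j => k; first by rewrite -PoszD addn1.
case: k => [|k]; first by rewrite /= !radjK.
have -> : (Negz k.+1 + 1 = Negz k)%R by rewrite !NegzE; lia.
by rewrite /= !radjK.
Qed.

Lemma dadj0 a : dadj 0%R a = a. Proof. by []. Qed.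

Lemma dadj1 a : dadj 1%R a = ladj (ladj a). Proof. by []. Qed.

Lemma ladj2_inj : injective (fun a : A => ladj (ladj a)).
Proof. by move=> a b /(can_inj ladjK)/(can_inj ladjK). Qed.

(** Induction along an equivalence: identities about the automorphism
    [x |-> ladj (ladj x)] transfer in both directions because it is injective. *)
Lemma int_step_ind (Q : int -> Prop) :
  Q 0%R -> (forall j, Q j <-> Q (j + 1)%R) -> forall j, Q j.
Proof.
move=> Q0 QS; elim=> [//|k /QS|k kQ]; first by rewrite intS addrC.
by apply/QS; have -> : (- k.+1%:Z + 1 = - k%:Z)%R by lia.
Qed.

Lemma dadjD i j a : dadj (i + j)%R a = dadj i (dadj j a).
Proof.
move: i; apply: int_step_ind; first by rewrite add0r.
move=> i; have -> : (i + 1 + j = i + j + 1)%R by lia.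
by rewrite !dadjS; split=> [->//|/ladj2_inj].
Qed.

Lemma dadjM j a b : dadj j (a * b) = dadj j a * dadj j b.
Proof.
move: j; apply: int_step_ind => // j.
by rewrite !dadjS -!ladjM; split=> [->|/ladj2_inj].
Qed.

Lemma dadj_ladj j a : dadj j (ladj a) = ladj (dadj j a).
Proof.
move: j; apply: int_step_ind => // j.
by rewrite !dadjS; split=> [->|/ladj2_inj].
Qed.

Lemma dadj_le j a b : (dadj j a <= dadj j b) = (a <= b).
Proof. by move: j; apply: int_step_ind => // j; rewrite !dadjS !ladj_le. Qed.

Lemma dadj_one j : dadj j (1 : A) = 1.
Proof.
have e : ladj (ladj (1 : A)) = 1 by rewrite !ladj1.
move: j; apply: int_step_ind => // j; rewrite dadjS.
by split=> [->//|]; rewrite -[X in _ = X -> _]e => /ladj2_inj.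
Qed.

Lemma periodic_dadjP n : n_periodic A n <-> forall a, dadj n%:Z a = a.
Proof. by split=> h a; apply/iter_ladj2P; apply: h. Qed.

Lemma dadj_mul n (k : int) a : (forall b, dadj n%:Z b = b) -> dadj (n%:Z * k)%R a = a.
Proof.
move=> na; move: k; apply: int_step_ind => [|k]; first by rewrite mulr0.
by rewrite mulrDr mulr1 addrC dadjD na.
Qed.

End DoubleAdjoint.

Lemma radj1 {d} {A : lpregroupType d} : radj (1 : A) = 1.
Proof. by rewrite -{1}(ladj1 (A := A)) ladjK. Qed.

(** * Closure elements *)
Section Closure.
Context {d : Order.disp_t} {A : lpregroupType d}.
Implicit Types a c : A.

(** In [FZ] these are the closure operators, determined by their sets of fixed
    points. *)
Definition closure_elt c := 1 <= c /\ c * c = c.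

Lemma lp_mul_ge1l a c : 1 <= c -> a <= c * a.
Proof. by move=> /(lp_mul2r a); rewrite mul1g. Qed.

Lemma lp_mul_ge1r a c : 1 <= c -> a <= a * c.
Proof. by move=> /(lp_mul2l a); rewrite mulg1. Qed.

(** [ladj c] is the interior operator adjoint to [c], so composing it with [c]
    in either order gives back the outer factor. *)
Lemma closure_ladj c : closure_elt c -> c * ladj c = c.
Proof.
move=> [c1 cc]; apply/eqP; rewrite eq_le; apply/andP; split.
  by rewrite -[leRHS]mulg1 lp_mul2l// -(ladj1 (A := A)) ladj_anti.
by rewrite -{2}cc -mulgA -[leLHS]mulg1 lp_mul2l// Mladj_ge1.
Qed.

Lemma ladj_closure c : closure_elt c -> ladj c * c = ladj c.
Proof.
move=> [c1 cc]; apply/eqP; rewrite eq_le lp_mul_ge1r// andbT.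
by rewrite -{1}cc ladjM -[leRHS]mulg1 -mulgA lp_mul2l// ladjM_le1.
Qed.

Lemma mul_ladj_closure a : closure_elt (a * ladj a).
Proof.
split; first exact: Mladj_ge1.
apply/eqP; rewrite eq_le lp_mul_ge1l ?Mladj_ge1// andbT.
rewrite mulgA; apply: lp_mul2r; rewrite -mulgA -[leRHS]mulg1.
by apply: lp_mul2l; exact: ladjM_le1.
Qed.

Lemma dadj_closure j c : closure_elt c -> closure_elt (dadj j c).
Proof. by move=> [c1 cc]; split; rewrite -?dadjM ?cc// -(dadj_one j) dadj_le. Qed.

End Closure.

(** * Actions on chains, covers and blocks *)
Record chain_action d (A : lpregroupType d) d' (T : orderType d')
    (act : A -> T -> T) : Prop := ChainAction {
  act1 : forall w, act 1 w = w;
  actM : forall a b w, act (a * b) w = act a (act b w);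
  act_homo : forall a, {homo act a : u v / u <= v};
  actI : forall a b w, act (Order.meet a b) w = Order.min (act a w) (act b w);
  actU : forall a b w, act (Order.join a b) w = Order.max (act a w) (act b w)
}.

Section Covers.
Context {d' : Order.disp_t} {T : orderType d'}.
Implicit Types (t u v w : T) (W Z : int -> T) (i j : int).

Definition covers u v := u < v /\ forall t, t <= u \/ v <= t.

Lemma covers_le_pred u v t : covers u v -> (t < v) = (t <= u).
Proof.
move=> [uv /(_ t)]; case=> h; first by rewrite h (le_lt_trans h uv).
by rewrite ltNge h leNgt (lt_le_trans uv h).
Qed.

Lemma covers_succ_le u v t : covers u v -> (u < t) = (v <= t).
Proof. by move=> uv; rewrite ltNge -(covers_le_pred t uv) -leNgt. Qed.

Lemma covers_eqr u v v' : covers u v -> covers u v' -> v = v'.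
Proof.
by move=> h h'; apply/eqP; rewrite eq_le -!(covers_succ_le _ h) ?h'.1 ?h.1//=
  -(covers_succ_le _ h') h.1.
Qed.

Lemma covers_eql u u' v : covers u v -> covers u' v -> u = u'.
Proof.
by move=> h h'; apply/eqP; rewrite eq_le -(covers_le_pred _ h)
  -(covers_le_pred _ h') h.1 h'.1.
Qed.

(** A convex copy of the integers inside the chain. *)
Definition block W := forall i, covers (W i) (W (i + 1)%R).

Lemma block_lt W : block W -> {mono W : i j / (i < j)%R >-> i < j}.
Proof.
move=> bW; have lt (i : int) (k : nat) : W i < W (i + k.+1%:Z)%R.
  elim: k => [|k IH]; first exact: (bW i).1.
  apply: lt_trans IH _; have := (bW (i + k.+1%:Z)%R).1.
  by rewrite (_ : (_ + 1 = i + k.+2%:Z)%R)//; lia.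
have lt' i j : (i < j)%R -> W i < W j.
  move=> ij; have -> : j = (i + (`|(j - i)%R|.-1.+1)%:Z)%R by lia.
  exact: lt.
move=> i j; case: (ltgtP i j) => [/lt'//|/lt'/lt_gtF//|->]; exact: ltxx.
Qed.

Lemma block_le W : block W -> {mono W : i j / (i <= j)%R >-> i <= j}.
Proof. by move=> bW i j; rewrite !leNgt block_lt. Qed.

Lemma block_inj W : block W -> injective W.
Proof. by move=> bW i j /eqP; rewrite eq_le !block_le// => /andP[]; lia. Qed.

Lemma block_convex W i j t : block W -> W i <= t -> t <= W j ->
  exists k, t = W k.
Proof.
move=> bW; have [k kE] : exists k : nat, (j <= i + k%:Z)%R by exists `|(j - i)%R|%N; lia.
move=> it tj; have {tj} : t <= W (i + k%:Z)%R by rewrite (le_trans tj)// block_le.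
elim: k {kE} => [|k IH] tk.
  by exists i; apply/eqP; rewrite eq_le it; rewrite addr0 in tk; rewrite tk.
move: tk; rewrite le_eqVlt => /predU1P[->|]; first by exists (i + k.+1%:Z)%R.
have := bW (i + k%:Z)%R; have -> : (i + k%:Z + 1 = i + k.+1%:Z)%R by lia.
by move=> /covers_le_pred ->; exact: IH.
Qed.

Lemma block_uniq W Z i : block W -> block Z -> W i = Z i -> forall j, W j = Z j.
Proof.
move=> bW bZ WZ j; have -> : (j = (j - i) + i)%R by lia.
move: (j - i)%R; apply: int_step_ind => [|k]; first by rewrite add0r.
have := bW (k + i)%R; have := bZ (k + i)%R.
have -> : (k + i + 1 = k + 1 + i)%R by lia.
move=> hZ hW; split=> E.
  by rewrite E in hW; exact: covers_eqr hW hZ.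
by rewrite E in hW; exact: covers_eql hW hZ.
Qed.

End Covers.

Section ChainAction.
Context {d : Order.disp_t} {A : lpregroupType d} {d' : Order.disp_t}
  {T : orderType d'} {act : A -> T -> T} (act_chain : chain_action act).
Implicit Types (a b c : A) (t u v w p q : T) (W Z : int -> T) (i j : int).

Local Notation act1 := (act1 act_chain).
Local Notation actM := (actM act_chain).
Local Notation act_homo := (act_homo act_chain).

Lemma act_le a b w : a <= b -> act a w <= act b w.
Proof. by move=> /meet_idPl <-; rewrite (actI act_chain) ge_min lexx orbT. Qed.

(** An action turns the defining inequalities of [ladj] into a Galois
    connection between maps of the chain. *)
Lemma act_ladj a p q : (act (ladj a) q <= p) = (q <= act a p).
Proof.
apply/idP/idP => h.
  rewrite -[q]act1 (le_trans (act_le _ (Mladj_ge1 a)))// actM; exact: act_homo.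
rewrite -[leRHS]act1 (le_trans _ (act_le _ (ladjM_le1 a)))// actM; exact: act_homo.
Qed.

Lemma act_radj a p q : (p <= act (radj a) q) = (act a p <= q).
Proof. by rewrite -{2}[a]radjK act_ladj. Qed.

(** If [v] covers [u], every [act a t] is either at most [u] or at least [v]; the
    adjoints turn this into the same dichotomy for [t].  This is what makes the
    double adjoint behave like conjugation by the successor function. *)
Lemma covers_adj a u v : covers u v -> covers (act (radj a) u) (act (ladj a) v).
Proof.
move=> uv; split=> [|t]; last by rewrite act_ladj act_radj; exact: uv.2.
rewrite ltNge; apply/negP; rewrite act_ladj => h.
suff : act a (act (radj a) u) <= u by rewrite leNgt (lt_le_trans uv.1 h).
by rewrite -act_radj.
Qed.

Lemma covers_act a u v : covers u v -> covers (act a u) (act (dadj 1%R a) v).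
Proof. by move=> /(covers_adj (ladj a)); rewrite ladjK. Qed.

Lemma covers_actV a u v : covers u v -> covers (act (radj (radj a)) u) (act a v).
Proof. by move=> /(covers_adj (radj a)); rewrite radjK. Qed.

(** A point [q] that [a] skips makes a jump in the domain of [a]. *)
Lemma covers_gap a q : act (radj a) q < act (ladj a) q ->
  covers (act (radj a) q) (act (ladj a) q).
Proof.
move=> h; split=> // t; rewrite act_ladj act_radj.
by case: (leP (act a t) q) => [|/ltW]; [left|right].
Qed.

Lemma block_act W j a : block W -> block (fun i => act (dadj (i + j)%R a) (W i)).
Proof.
move=> bW i /=; have -> : (i + 1 + j = 1 + (i + j))%R by lia.
by rewrite (dadjD 1%R); exact: covers_act.
Qed.

(** The two halves of a block, which are produced separately. *)
Definition up_chain w := exists s : nat -> T, s 0 = w /\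
  forall k, covers (s k) (s k.+1).
Definition down_chain w := exists s : nat -> T, s 0 = w /\
  forall k, covers (s k.+1) (s k).

(** If [act a w] covers [w], applying [dadj 1] repeatedly to the element that
    leads from [w] to the current point produces the next cover. *)
Lemma up_chain_orbit a w : covers w (act a w) -> up_chain w.
Proof.
move=> wa; pose b := fix b k := if k is k'.+1 then dadj 1%R (b k') * a else 1.
exists (fun k => act (b k) w); split=> [|k]; first exact: act1.
by rewrite actM; exact: covers_act.
Qed.

Lemma up_chain_act a w : up_chain w -> up_chain (act a w).
Proof.
move=> [s [<- sP]]; exists (fun k => act (dadj k%:Z a) (s k)); split=> // k.
by rewrite -addn1 PoszD addrC dadjD addn1; exact: covers_act.
Qed.

Lemma down_chain_orbit a w : covers (act a w) w -> down_chain w.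
Proof.
move=> wa; pose b := fix b k := if k is k'.+1 then radj (radj (b k')) * a else 1.
exists (fun k => act (b k) w); split=> [|k]; first exact: act1.
by rewrite actM; exact: covers_actV.
Qed.

Lemma block_of_chains u v : down_chain u -> covers u v -> up_chain v ->
  exists2 W, block W & W (-1)%R = u /\ W 0%R = v.
Proof.
move=> [s [s0 sP]] uv [t [t0 tP]].
exists (fun i => match i with Posz k => t k | Negz k => s k end) => // -[k|k].
- by rewrite -PoszD addn1.
case: k => [|k]; first by rewrite /= s0 t0.
by have -> : (Negz k.+1 + 1 = Negz k)%R by rewrite !NegzE; lia.
Qed.

(** With [c1 = dadj 1 c], the point [w = act c p] is not fixed by [c1], which
    gives a jump right above [act (ladj c) w].  The element [c] carries it to
    a jump right above [w], whose upper end is [act c1 w]. *)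
Lemma closure_up_chain c p : closure_elt c -> act c p != p -> up_chain (act c p).
Proof.
move=> cc cp; set w := act c p.
have lt_pw : p < w by rewrite lt_neqAle eq_sym cp -{1}[p]act1 act_le ?cc.1.
set c1 := dadj 1%R c; have c1P : closure_elt c1 by exact: dadj_closure.
have vp : act (ladj c) w <= p by rewrite act_ladj.
have gap : covers (act (ladj c) w) (act (ladj c1) w).
  have rc1 : radj c1 = ladj c by rewrite /c1 dadj1 ladjK.
  rewrite -rc1; apply: covers_gap; rewrite rc1 ltNge act_ladj.
  rewrite -actM -ladjM (closure_ladj cc) -ltNge; exact: le_lt_trans vp lt_pw.
have cw : act c w = w by rewrite /w -actM cc.2.
have := covers_act c gap; rewrite -/c1 -(actM c) -(actM c1).
rewrite (closure_ladj cc) (closure_ladj c1P) cw.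
exact: up_chain_orbit.
Qed.

Lemma closure_radj_fix c p : closure_elt c ->
  act c (act (radj c) p) = act (radj c) p.
Proof.
move=> cc; apply/eqP; rewrite eq_le act_radj -actM cc.2 -act_radj lexx /=.
by rewrite -{1}[act (radj c) p]act1 act_le ?cc.1.
Qed.

(** The order dual of [closure_up_chain], for the interior element [radj c]. *)
Lemma closure_down_chain c p : closure_elt c -> act c p != p ->
  down_chain (act (radj c) p).
Proof.
move=> cc cp; set o := radj c; set u := act o p; set o1 := radj (radj o).
have lt_up : u < p.
  rewrite ltNge; apply: contra cp => pu.
  rewrite eq_le; apply/andP; split; first by rewrite -act_radj.
  by rewrite -{1}[p]act1 act_le ?cc.1.
have oc : ladj o = c by exact: radjK.
have oo : o * radj o = o.
  by apply: ladj2_inj; rewrite /= !ladjM radjK oc (ladj_closure cc).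
have vp : p <= act (radj o) u by rewrite act_radj.
have gap : covers (act (radj o1) u) (act (radj o) u).
  have lo1 : ladj o1 = radj o by exact: radjK.
  rewrite -lo1; apply: covers_gap; rewrite lo1 ltNge act_radj.
  rewrite -actM (_ : o1 * radj o = radj o).
    by rewrite -ltNge; exact: lt_le_trans lt_up vp.
  by apply: (can_inj ladjK); rewrite ladjM lo1 radjK oo.
have o1o1 : o1 * radj o1 = o1.
  by apply: ladj2_inj; rewrite /= !ladjM !radjK oo.
have ou : act o u = u.
  by rewrite /u -actM; congr act; apply: (can_inj ladjK); rewrite ladjM oc cc.2.
have := covers_actV o gap; rewrite -/o1 -(actM o) -(actM o1) oo o1o1 ou.
exact: down_chain_orbit.
Qed.

(** A point [p] moved by [c] lies strictly between the consecutive fixed points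
    [u = act (radj c) p] and [w = act c p].  Here [u] starts a downward chain
    and its cover an upward one; periodicity makes [c] fix a point of the
    resulting block above [u], hence above [p], so that [p] is enclosed. *)
Lemma closure_block n c p : (0 < n)%N -> n_periodic A n -> closure_elt c ->
  act c p != p -> exists W i, block W /\ W i = p.
Proof.
move=> n0 /periodic_dadjP nA cc cp; set u := act (radj c) p; set w := act c p.
have cu : act c u = u by exact: closure_radj_fix.
have up : u < p.
  rewrite lt_neqAle; apply/andP; split.
    by apply: contra cp => /eqP <-; rewrite cu.
  by rewrite -[leRHS]act1 -(radj1 (A := A)); apply: act_le; rewrite radj_anti ?cc.1.
have lv : act (ladj c) w = act (ladj c) p by rewrite /w -actM ladj_closure.
have uv : covers u (act (ladj c) p).
  apply: covers_gap; rewrite ltNge act_ladj cu -ltNge //.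
have vup : up_chain (act (ladj c) p).
  by rewrite -lv; apply: up_chain_act; exact: closure_up_chain.
have [W bW [Wu Wv]] := block_of_chains (closure_down_chain cc cp) uv vup.
(* applying the powers of the automorphism to [c] maps [W] to a block meeting
   [W] in its fixed point [u], hence to [W] itself *)
have fixW : act c (W (n%:Z - 1)%R) = W (n%:Z - 1)%R.
  have := block_uniq (i := (-1)%R) (block_act 1%R c bW) bW.
  rewrite addNr dadj0 Wu cu => /(_ erefl (n%:Z - 1)%R).
  by rewrite subrK nA.
have pW : p <= W (n%:Z - 1)%R.
  have : act (ladj c) p <= W (n%:Z - 1)%R by rewrite -Wv block_le//; lia.
  by rewrite act_ladj fixW.
have Wp : W (-1)%R <= p by rewrite Wu ltW.
have [k pk] := block_convex bW Wp pW.
by exists W, k.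
Qed.

(** Where [ladj (ladj a)] and [a] act differently, some closure element built
    from [a] moves a point: either [w] itself, or a point that [ladj a] maps to
    [w]. *)
Lemma block_of_shift n a w : (0 < n)%N -> n_periodic A n ->
  act (dadj 1%R a) w != act a w -> exists W i, block W /\ W i = w.
Proof.
move=> n0 nA; set b := dadj 1%R a => ab.
have cl_b := mul_ladj_closure (ladj a); rewrite -[ladj (ladj a)]/b in cl_b.
have [ew|ew] := eqVneq (act (ladj a * b) w) w; last exact: closure_block n0 nA cl_b ew.
have ew' : act (ladj a) (act b w) = w by rewrite -actM.
have ba : act b w < act a w.
  rewrite lt_neqAle ab act_ladj -{1}ew'; apply: act_homo.
  by rewrite -{2}ew' -actM -{1}[act b w]act1 act_le ?Mladj_ge1.
have [|W [i [bW Wi]]] := closure_block n0 nA (mul_ladj_closure a) (p := act b w).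
  by rewrite actM ew' gt_eqF.
exists (fun j => act (dadj (j - i)%R (ladj a)) (W j)), i; split.
  exact: block_act.
by rewrite subrr dadj0 Wi.
Qed.

(** The points [act (dadj i a) (W i)] form a block; by periodicity they are the
    points [act a (W i)] when [n] divides [i], and convexity does the rest. *)
Lemma block_transport n a W : (0 < n)%N -> n_periodic A n -> block W ->
  exists Z (f : FZ), block Z /\ forall i, act a (W i) = Z (f i).
Proof.
move=> n0 /periodic_dadjP nA bW; pose Z i := act (dadj i a) (W i).
have bZ : block Z.
  by move=> i; have := block_act 0%R a bW i; rewrite !addr0.
have aW k : act a (W (n%:Z * k)%R) = Z (n%:Z * k)%R by rewrite /Z dadj_mul.
have ex i : exists j, act a (W i) = Z j.
  apply: (block_convex (i := (n%:Z * (i %/ n%:Z)%Z)%R)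
    (j := (n%:Z * ((i %/ n%:Z)%Z + 1))%R) bZ).
    by rewrite -aW act_homo// block_le// mulrC lez_floor//; lia.
  by rewrite -aW act_homo// block_le// mulrC ltW// ltz_ceil//; lia.
have /choice[f fP] := ex.
have fn k : f (n%:Z * k)%R = (n%:Z * k)%R.
  by apply: (block_inj bZ); rewrite -fP aW.
have fz_f : f \in fz.
  apply/fzP; split=> [x y xy|q|q].
  - by rewrite -(block_le bZ) -!fP act_homo// block_le.
  - by exists (n%:Z * `|q|%:Z)%R; rewrite fn; nia.
  - by exists (n%:Z * - `|q|%:Z)%R; rewrite fn; nia.
by exists Z, (MkFZ fz_f).
Qed.

End ChainAction.

(** * Order-preserving functions on the integers *)
Section FZCalculus.
Implicit Types (f g h : FZ) (x y i j : int).

Lemma FZ_mulE f g x : (f * g) x = f (g x). Proof. by []. Qed.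

Lemma FZ_meetE f g x : (Order.meet f g) x = Order.min (f x) (g x).
Proof. by rewrite -meetEtotal. Qed.

Lemma FZ_joinE f g x : (Order.join f g) x = Order.max (f x) (g x).
Proof. by rewrite -joinEtotal. Qed.

Lemma FZ_ext f g : (forall x, f x = g x) -> f = g.
Proof. by move=> h; apply: val_inj; apply/funext. Qed.

Lemma FZ_homoW f x y : (x <= y)%R -> (f x <= f y)%R.
Proof. exact: fz_homo. Qed.

Lemma FZ_ladjP f q p : (ladj f q <= p)%R = (q <= f p)%R.
Proof. exact: ladj_funP. Qed.

Lemma FZ_radjP f q p : (p <= radj f q)%R = (f p <= q)%R.
Proof. exact: radj_funP. Qed.

Lemma FZ_dadjE j f x : dadj j f x = (f (x - j) + j)%R.
Proof.
move: j x; apply: int_step_ind => [x|j]; first by rewrite subr0 addr0.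
have dbl h x : ladj (ladj h) x = (h (x - 1) + 1)%R.
  have key p : (ladj (ladj h) x <= p)%R = (h (x - 1) + 1 <= p)%R.
    rewrite FZ_ladjP; have := FZ_ladjP h p (x - 1)%R; lia.
  by have := key (ladj (ladj h) x); have := key (h (x - 1) + 1)%R; lia.
split=> E x.
  rewrite dadjS dbl E.
  by rewrite (_ : (x - 1 - j = x - (j + 1))%R); lia.
have := E (x + 1)%R; rewrite dadjS dbl addrK.
by rewrite (_ : (x + 1 - (j + 1) = x - j)%R); lia.
Qed.

Lemma FZ_closureP g : closure_elt g ->
  (forall x, (x <= g x)%R) /\ (forall x, g (g x) = g x).
Proof. by move=> [/FZ_leP g1 gg]; split=> [|x]; [exact: g1|rewrite -FZ_mulE gg]. Qed.

End FZCalculus.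

Lemma dvdn_divp n p d : (0 < n)%N -> prime p -> (p %| n)%N -> (d %| n)%N ->
  ~~ (p ^ logn p n %| d)%N -> (d %| n %/ p)%N.
Proof.
move=> n0 pp pn /dvdnP[e nE]; rewrite pfactor_dvdn//; last first.
  by move: n0; rewrite nE muln_gt0 => /andP[].
have [e0 d0] : (0 < e)%N /\ (0 < d)%N by move: n0; rewrite nE muln_gt0 => /andP[].
rewrite {1}nE lognM// -ltnNge -[X in (X < _)%N]add0n ltn_add2r logn_gt0 mem_primes.
move=> /and3P[_ _ /dvdnP[e' eE]]; rewrite nE eE mulnAC mulnK ?prime_gt0//.
exact: dvdn_mull.
Qed.

Section KernelImage.
Implicit Types (f h : FZ) (x y : int).
Local Open Scope ring_scope.

(** Two functions with the same kernel and the same image differ by an order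
    automorphism of the image.  The image is a copy of the integers, so this
    automorphism is a translation of it: it moves all points in the same
    direction. *)
Lemma same_kernel_image_step f h x : (f * ladj f = h * ladj h)%g ->
  (ladj f * f = ladj h * h)%g -> f x < h x -> f (x + 1) < h (x + 1).
Proof.
move=> im ker fh.
have kerE y z : (f y <= f z) = (h y <= h z).
  by rewrite -!FZ_ladjP -(FZ_mulE (ladj f)) -(FZ_mulE (ladj h)) ker.
have imE f' y : (f' * ladj f')%g (f' y) = f' y.
  rewrite FZ_mulE; apply/eqP; rewrite eq_le; apply/andP; split.
    by apply: FZ_homoW; rewrite FZ_ladjP.
  by rewrite -FZ_ladjP.
have imfh y : f y = h (ladj h (f y)) by rewrite -(FZ_mulE h) -im imE.
have imhf y : h y = f (ladj f (h y)) by rewrite -(FZ_mulE f) im imE.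
have [ff|ff] := boolP (f (x + 1) <= f x).
  have := kerE (x + 1) x; rewrite ff => /esym h1.
  have := FZ_homoW f (_ : x <= x + 1); have := FZ_homoW h (_ : x <= x + 1); lia.
(* h x lies in the image of f, strictly above f x, hence at f (x+1) or more *)
have fx1 : f (x + 1) <= h x.
  rewrite imhf; apply: FZ_homoW.
  suff : x < ladj f (h x) by lia.
  by rewrite ltNge; apply/negP => /(FZ_homoW f); rewrite -imhf; lia.
have := kerE (x + 1) x; lia.
Qed.

(** If kernel and image of [f] are invariant under the translation by [m], then
    [f] and its conjugate have the same kernel and image.  By
    [same_kernel_image_step] a discrepancy between them keeps its sign and
    accumulates over [p] steps of length [m], against periodicity. *)
Lemma shift_eq_of_kernel_image f (m p : nat) : (0 < p)%N ->
  dadj (p * m)%N%:Z f = f ->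
  dadj m%:Z (f * ladj f)%g = (f * ladj f)%g ->
  dadj m%:Z (ladj f * f)%g = (ladj f * f)%g -> dadj m%:Z f = f.
Proof.
move=> p0 fn im ker; apply: contrapT => neq.
set h := dadj m%:Z f in neq.
rewrite dadjM dadj_ladj -/h in im; rewrite dadjM dadj_ladj -/h in ker.
have [x hx] : exists x, h x != f x.
  by apply: contrapT => /forallNP e; apply: neq; apply: FZ_ext => x;
    have /negP := e x; rewrite negbK => /eqP.
have hE y : h y = f (y - m%:Z) + m%:Z by exact: FZ_dadjE.
have up k f1 f2 : (f1 * ladj f1 = f2 * ladj f2)%g ->
    (ladj f1 * f1 = ladj f2 * f2)%g -> f1 x < f2 x ->
    f1 (x + k%:Z) < f2 (x + k%:Z).
  move=> i e lt; elim: k => [|k IH]; first by rewrite addr0.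
  have -> : x + k.+1%:Z = x + k%:Z + 1 by lia.
  exact: same_kernel_image_step.
have per : f (x + (p * m)%N%:Z) = f x + (p * m)%N%:Z.
  by rewrite -{1}fn FZ_dadjE addrK.
have step k : h (x + (k.+1 * m)%N%:Z) = f (x + (k * m)%N%:Z) + m%:Z.
  by rewrite hE; congr (f _ + _); lia.
case: (ltgtP (h x) (f x)) hx => // lt _.
- have dec k : (0 < k)%N -> f x + (k * m)%N%:Z < f (x + (k * m)%N%:Z).
    case: k => // k _; elim: k => [|k IH].
      have := up (1 * m)%N _ _ im ker lt; rewrite step mul0n addr0; lia.
    have := up (k.+2 * m)%N _ _ im ker lt; rewrite step; lia.
  by have := dec p p0; rewrite per ltxx.
- have dec k : (0 < k)%N -> f (x + (k * m)%N%:Z) < f x + (k * m)%N%:Z.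
    case: k => // k _; elim: k => [|k IH].
      have := up (1 * m)%N _ _ (esym im) (esym ker) lt; rewrite step mul0n addr0; lia.
    have := up (k.+2 * m)%N _ _ (esym im) (esym ker) lt; rewrite step; lia.
  by have := dec p p0; rewrite per ltxx.
Qed.

End KernelImage.

(** * Subalgebras of [FZ] containing all staircases *)
Record subalgebra d (A : lpregroupType d) (R : A -> Prop) : Prop := Subalgebra {
  sub1 : R 1;
  subM : forall f g, R f -> R g -> R (f * g);
  subI : forall f g, R f -> R g -> R (Order.meet f g);
  subU : forall f g, R f -> R g -> R (Order.join f g);
  sub_ladj : forall f, R f -> R (ladj f);
  sub_radj : forall f, R f -> R (radj f)
}.

Lemma sub_dadj d (A : lpregroupType d) (R : A -> Prop) j f :
  subalgebra R -> R f -> R (dadj j f).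
Proof.
move=> sR Rf; move: j; apply: int_step_ind => // j; rewrite dadjS; split=> [Rj|].
  by do 2 apply: sub_ladj => //.
by move=> /(sub_radj sR)/(sub_radj sR); rewrite !ladjK.
Qed.

Section Stairs.
Implicit Types (x y i j a b c : int) (f g h : FZ).
Local Open Scope ring_scope.

Lemma divzMDr (q : nat) y k : (0 < q)%N -> ((y + q%:Z * k) %/ q)%Z = (y %/ q)%Z + k.
Proof.
move=> q0; rewrite addrC mulrC divzMDl; last by rewrite -lt0n.
exact: addrC.
Qed.

Lemma divz_bounds (q : nat) y : (0 < q)%N ->
  q%:Z * (y %/ q)%Z <= y < q%:Z * (y %/ q)%Z + q%:Z.
Proof.
move=> q0; have := lez_floor y (_ : q%:Z != 0); have := ltz_ceil y (_ : 0 < q%:Z).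
by rewrite mulrDl mul1r mulrC => -> // -> //; rewrite -lt0n.
Qed.

(** The function of period [q] with a single value on [[a, a + q)], namely
    [b]. *)
Definition stair (q : nat) a b y := b + q%:Z * ((y - a) %/ q)%Z.

Definition has_stair (R : FZ -> Prop) q a b := exists2 h, R h & h =1 stair q a b.

Variables (R : FZ -> Prop) (sR : subalgebra R) (q : nat).
Hypothesis q_gt1 : (1 < q)%N.

Let q0 : (0 < q)%N. Proof. exact: ltnW. Qed.

(** The first staircase only takes values congruent to [b] modulo [q], on which
    the second one is a translation. *)
Lemma has_stair_comp a b a' c : has_stair R q a b -> has_stair R q a' c ->
  has_stair R q a (c + q%:Z * ((b - a') %/ q)%Z).
Proof.
move=> [h Rh hE] [h' Rh' hE']; exists (h' * h)%g; first exact: subM.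
move=> y; rewrite FZ_mulE hE hE' /stair.
have -> : b + q%:Z * ((y - a) %/ q)%Z - a' = (b - a') + q%:Z * ((y - a) %/ q)%Z by lia.
by rewrite divzMDr// mulrDr; lia.
Qed.

(** The hypotheses say that [h] is the closure operator onto the multiples of
    [q].  Its conjugates are staircases that lift [a] to [a + q - 1], and those
    of its left adjoint are staircases that fix [a]; composing them moves the
    value of a staircase by one in either direction. *)
Lemma ceil_generates_stairs h : R h -> (forall x, x <= h x) ->
  (forall x, (q%:Z %| h x)%Z) -> (forall k, h (q%:Z * k) = q%:Z * k) ->
  forall a b, has_stair R q a b.
Proof.
move=> Rh h1 hq hfix.
have up z k : z <= q%:Z * k -> h z <= q%:Z * k.
  by move=> zk; rewrite -hfix; exact: FZ_homoW.
have shiftU i : has_stair R q i (i + q%:Z - 1).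
  exists (dadj (i - 1) h); first exact: sub_dadj.
  move=> y; rewrite FZ_dadjE /stair.
  have /dvdzP[k hk] := hq (y - (i - 1)).
  have := h1 (y - (i - 1)); have /andP[] := divz_bounds (y - i) q0.
  set t := ((y - i) %/ q)%Z => t1 t2.
  have := up (y - (i - 1)) (t + 1).
  rewrite hk => k1 k2.
  suff -> : k = t + 1 by lia.
  have : t < k by nia.
  have : k <= t + 1 by nia.
  lia.
have shiftD i : has_stair R q i i.
  exists (dadj (i - 1) (ladj h)); first by apply: sub_dadj => //; exact: sub_ladj.
  move=> y; rewrite FZ_dadjE /stair.
  have /andP[] := divz_bounds (y - i) q0.
  set t := ((y - i) %/ q)%Z => t1 t2.
  suff -> : ladj h (y - (i - 1)) = q%:Z * t + 1 by lia.
  apply/eqP; rewrite eq_le FZ_ladjP; apply/andP; split.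
    have /dvdzP[k hk] := hq (q%:Z * t + 1); have := h1 (q%:Z * t + 1).
    rewrite hk => tk; have : t < k by nia.
    by nia.
  suff : ~~ (ladj h (y - (i - 1)) <= q%:Z * t) by lia.
  by rewrite FZ_ladjP hfix; lia.
have one a k : has_stair R q a (a + k%:Z) /\ has_stair R q a (a - k%:Z).
  elim: k => [|k [IH1 IH2]]; first by rewrite !addr0; split; exact: shiftD.
  split.
    have := has_stair_comp IH1 (shiftU (a + k%:Z + 2 - q%:Z)).
    have -> : ((a + k%:Z - (a + k%:Z + 2 - q%:Z)) %/ q)%Z = 0.
      by apply: divz_small; lia.
    by rewrite (_ : _ + _ * 0 = a + k.+1%:Z)//; lia.
  have := has_stair_comp IH2 (shiftD (a - k%:Z - 1)).
  have -> : ((a - k%:Z - (a - k%:Z - 1)) %/ q)%Z = 0.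
    by apply: divz_small; lia.
  by rewrite (_ : _ + _ * 0 = a - k.+1%:Z)//; lia.
move=> a b; have [ab|ab] := leP a b.
  by have [+ _] := one a `|b - a|%N; rewrite (_ : _ + _ = b)//; lia.
by have [_ +] := one a `|b - a|%N; rewrite (_ : _ - _ = b)//; lia.
Qed.

(** A periodic [f] is the join of the staircases through its values at
    [0, ..., q - 1]. *)
Lemma stairs_generate_periodic : (forall a b, has_stair R q a b) ->
  forall f, dadj q%:Z f = f -> R f.
Proof.
move=> st f fq.
have fS y : f (y + q%:Z) = f y + q%:Z by rewrite -{1}fq FZ_dadjE addrK.
have fSk y k : f (y + q%:Z * k) = f y + q%:Z * k.
  move: k; apply: int_step_ind => [|k]; first by rewrite mulr0 !addr0.
  have -> : y + q%:Z * (k + 1) = y + q%:Z * k + q%:Z by lia.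
  by rewrite fS; split; lia.
have le_stair x y : stair q x (f x) y <= f y.
  rewrite /stair -fSk; apply: FZ_homoW.
  have /andP[] := divz_bounds (y - x) q0; lia.
have key (N : nat) : exists2 h, R h &
    forall y, h y <= f y /\ forall x : nat, (x <= N)%N -> stair q x%:Z (f x%:Z) y <= h y.
  elim: N => [|N [h Rh hP]].
    have [h Rh hE] := st 0 (f 0); exists h => // y; rewrite hE; split=> //.
    by case.
  have [h' Rh' hE'] := st N.+1%:Z (f N.+1%:Z); exists (Order.join h h') => //.
    exact: subU.
  move=> y; have [hf hx] := hP y; rewrite FZ_joinE hE'; split.
    by rewrite ge_max hf le_stair.
  move=> x; rewrite leq_eqVlt ltnS => /predU1P[->|/hx xh]; rewrite le_max ?lexx ?orbT//.
  by rewrite xh.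
have [h Rh hP] := key q; suff -> : f = h by [].
apply: FZ_ext => y; apply/eqP; rewrite eq_le (hP y).1 andbT.
have /andP[] := divz_bounds y q0; set t := (y %/ q)%Z => t1 t2.
pose r := y - q%:Z * t.
have := (hP y).2 `|r|%N; have -> : `|r|%N%:Z = r by lia.
have -> : stair q r (f r) y = f y.
  rewrite /stair (_ : y - r = t * q%:Z); last lia.
  by rewrite mulzK; [rewrite -fSk; congr (f _); lia | lia].
by apply; lia.
Qed.

End Stairs.

(** * From an aperiodic closure operator to the staircases *)
Section Stabilizer.
Implicit Types (x y i j k : int) (f h : FZ).
Local Open Scope ring_scope.

Variables (R : FZ -> Prop) (sR : subalgebra R) (n p : nat) (g : FZ).
Hypotheses (n_gt0 : (0 < n)%N) (p_pr : prime p) (p_n : (p %| n)%N).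
Hypotheses (Rg : R g) (gn : dadj n%:Z g = g) (g_cl : closure_elt g).
Hypothesis gm : dadj (n %/ p)%N%:Z g <> g.
Let q := (p ^ logn p n)%N.

Let g1 x : x <= g x. Proof. by have [] := FZ_closureP g_cl. Qed.
Let gg x : g (g x) = g x. Proof. by have [] := FZ_closureP g_cl. Qed.

Let gS x k : g (x + n%:Z * k) = g x + n%:Z * k.
Proof.
have gS1 y : g (y + n%:Z) = g y + n%:Z by rewrite -{1}gn FZ_dadjE addrK.
move: k; apply: int_step_ind => [|k]; first by rewrite mulr0 !addr0.
have -> : x + n%:Z * (k + 1) = x + n%:Z * k + n%:Z by lia.
by rewrite gS1; split; lia.
Qed.

(** The stabilizer of the set of fixed points of [g]. *)
Definition fix_stab y := forall j, g j = j -> g (j + y) = j + y.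

Lemma fix_stab_mul y k : fix_stab y -> fix_stab (k * y).
Proof.
move=> sy.
have nat_mul (m : nat) : fix_stab (m%:Z * y).
  elim: m => [|m IH] j gj; first by rewrite mul0r addr0.
  have -> : j + m.+1%:Z * y = (j + m%:Z * y) + y by lia.
  by apply: sy; exact: IH.
have /andP[] := divz_bounds k n_gt0; set t := (k %/ n)%Z => t1 _ j gj.
pose r := (k - n%:Z * t)%R; have kE : k = `|r|%N%:Z + n%:Z * t by lia.
have -> : j + k * y = j + `|r|%N%:Z * y + n%:Z * (t * y).
  by rewrite {1}kE mulrDl addrA mulrA.
by rewrite gS; congr (_ + _); exact: nat_mul.
Qed.

(** The stabilizer is a group containing [n].  If it contained a [y] that [q]
    does not divide, it would contain the gcd of [y] and [n], which divides
    [n / p], and [g] would be invariant under the translation by [n / p]. *)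
Lemma fix_stab_dvd y : fix_stab y -> (q%:Z %| y)%Z.
Proof.
move=> sy; apply: contrapT => /negP nq.
have [u [v uv]] := Bezoutz y n%:Z.
have sd : fix_stab (gcdz y n%:Z).
  move=> j gj; rewrite -uv addrA (mulrC v) gS; congr (_ + _).
  exact: fix_stab_mul.
have dm : (`|gcdz y n%:Z|%N %| n %/ p)%N.
  apply: dvdn_divp => //; first exact: dvdn_gcdr.
  apply: contra nq => qd; rewrite dvdzE absz_nat.
  exact: dvdn_trans qd (dvdn_gcdl _ _).
have sm k : fix_stab (k * (n %/ p)%N%:Z).
  apply: fix_stab_mul; have /dvdnP[e ->] := dm.
  by rewrite PoszM; apply: fix_stab_mul.
apply: gm; apply: FZ_ext => x; rewrite FZ_dadjE.
set m := (n %/ p)%N%:Z in sm *.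
have e1 := sm 1 _ (gg (x - m)); have e2 := sm (- 1) _ (gg x).
have h1 : g x <= g (g (x - m) + 1 * m) by apply: FZ_homoW; have := g1 (x - m); lia.
have h2 : g (x - m) <= g (g x + -1 * m) by apply: FZ_homoW; have := g1 x; lia.
rewrite e1 in h1; rewrite e2 in h2; apply/eqP; rewrite eq_le; lia.
Qed.

(** The product of those translates of [g] that fix [0]: its fixed points are
    their common fixed points, that is the [x] with [C + x] inside [C], where
    [C] is the set of fixed points of [g]. *)
Lemma exists_stab_op : exists h, [/\ R h, forall x, x <= h x,
  forall k, h (n%:Z * k) = n%:Z * k & forall x, h x = x -> fix_stab x].
Proof.
have key (N : nat) : exists h, [/\ R h, forall x, x <= h x,
    forall k, h (n%:Z * k) = n%:Z * k & forall x, h x = x ->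
    forall k : nat, (k < N)%N -> g (- k%:Z) = - k%:Z -> g (x - k%:Z) = x - k%:Z].
  elim: N => [|N [h [Rh h1 hn hx]]].
    by exists 1%g; split=> //; exact: sub1.
  have [gN|gN] := eqVneq (g (- N%:Z)) (- N%:Z); last first.
    exists h; split=> // x /hx{}hx k; rewrite ltnS leq_eqVlt => /predU1P[->/eqP|/hx//].
    by rewrite (negPf gN).
  exists (h * dadj N%:Z g)%g; split.
  - by apply: subM => //; exact: sub_dadj.
  - move=> x; rewrite FZ_mulE FZ_dadjE (le_trans _ (h1 _))//.
    by have := g1 (x - N%:Z); lia.
  - move=> k; rewrite FZ_mulE FZ_dadjE.
    have -> : n%:Z * k - N%:Z = - N%:Z + n%:Z * k by lia.
    by rewrite gS gN (_ : _ + N%:Z = n%:Z * k)//; lia.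
  move=> x; rewrite FZ_mulE FZ_dadjE => hE.
  have := h1 (g (x - N%:Z) + N%:Z); have := g1 (x - N%:Z); rewrite hE => l1 l2.
  have gx : g (x - N%:Z) = x - N%:Z by lia.
  rewrite gx subrK in hE; move=> k; rewrite ltnS leq_eqVlt => /predU1P[->//|].
  exact: hx.
have [h [Rh h1 hn hx]] := key n; exists h; split=> // x hxx j gj.
have /andP[] := divz_bounds (- j) n_gt0; set t := (- j %/ n)%Z => t1 t2.
pose r := - j - n%:Z * t.
have gr : g (- `|r|%N%:Z) = - `|r|%N%:Z.
  have -> : - `|r|%N%:Z = j + n%:Z * t by lia.
  by rewrite gS gj.
have rn : (`|r| < n)%N by lia.
have := hx x hxx `|r|%N rn gr.
have -> : x - `|r|%N%:Z = j + x + n%:Z * t by lia.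
by rewrite gS; lia.
Qed.

(** Iterating the operator of [exists_stab_op] gives a closure operator onto a
    set of multiples of [q] containing the multiples of [n]; the meet of its
    translates by multiples of [q] is the closure operator onto the union of
    the translated sets, which is the set of all multiples of [q]. *)
Lemma exists_ceil : exists h, [/\ R h, forall x, x <= h x,
  forall x, (q%:Z %| h x)%Z & forall k, h (q%:Z * k) = q%:Z * k].
Proof.
have [h0 [Rh0 h01 h0n h0x]] := exists_stab_op.
pose H := iter n (fun f => f * h0)%g 1%g.
have HE (N : nat) x : iter N.+1 (fun f => f * h0)%g 1%g x
   = iter N (fun f => f * h0)%g 1%g (h0 x) by [].
have RH : R H.
  by rewrite /H; elim: n => [|N IH]; [exact: sub1|exact: subM].
have H1 x : x <= H x.
  rewrite /H; elim: n x => [|N IH] x //; rewrite HE.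
  exact: le_trans (h01 x) (IH _).
have Hfix x : h0 x = x -> H x = x.
  by move=> e; rewrite /H; elim: n => [|N IH] //; rewrite HE e.
have Hn k : H (n%:Z * k) = n%:Z * k by apply: Hfix.
have Hq x : (q%:Z %| H x)%Z.
  apply/fix_stab_dvd/h0x.
  (* each iteration moves a point up until it is fixed, and the next multiple
     of n, at distance at most n, is fixed *)
  have [t [xB Bx]] : exists t, x <= n%:Z * t /\ n%:Z * t - x <= n%:Z.
    exists ((x %/ n)%Z + 1); have /andP[] := divz_bounds x n_gt0; lia.
  rewrite /H; elim: {3 4 5}n x xB Bx => [|N IH] x xB Bx.
    have -> : x = n%:Z * t by lia.
    exact: (h0n t).
  rewrite HE; have xh := h01 x.
  have hB : h0 x <= n%:Z * t by rewrite -h0n; apply: FZ_homoW.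
  have [e|ne] := eqVneq (h0 x) x; last by apply: IH => //; lia.
  rewrite e; suff -> : iter N (fun f => f * h0)%g 1%g x = x by [].
  by elim: N {IH Bx} => [|N IH] //; rewrite HE e.
have key (N : nat) : exists h, [/\ R h, forall x, x <= h x, forall x, (q%:Z %| h x)%Z
    & forall x (y : nat), (y < N)%N -> h x <= H (x - q%:Z * y%:Z) + q%:Z * y%:Z].
  elim: N => [|N [h [Rh h1 hq hy]]]; first by exists H; split.
  exists (Order.meet h (dadj (q%:Z * N%:Z) H)); split.
  - by apply: subI => //; exact: sub_dadj.
  - move=> x; rewrite FZ_meetE FZ_dadjE le_min h1 /=.
    by have := H1 (x - q%:Z * N%:Z); lia.
  - move=> x; rewrite FZ_meetE FZ_dadjE minEle; case: ifP => // _.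
    by rewrite rpredD// dvdz_mulr.
  move=> x y; rewrite FZ_meetE FZ_dadjE ltnS leq_eqVlt => /predU1P[->|/hy {}hy].
    by rewrite ge_min lexx orbT.
  by rewrite ge_min hy.
have [h [Rh h1 hq hy]] := key (n %/ q)%N; exists h; split=> // k.
have nE : n = (n %/ q * q)%N by rewrite divnK// pfactor_dvdnn.
have q0 : (0 < q)%N by rewrite expn_gt0 prime_gt0.
set r := (n %/ q)%N in nE hy.
have r0 : (0 < r)%N by move: n_gt0; rewrite nE muln_gt0 => /andP[].
have /andP[] := divz_bounds k r0; set t := (k %/ r)%Z => s1 s2.
pose s := k - r%:Z * t; have kE : k = s + r%:Z * t by rewrite subrK.
apply/eqP; rewrite eq_le h1 andbT.
apply: (le_trans (hy _ `|s|%N _)); first lia.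
have qk : q%:Z * k = n%:Z * t + q%:Z * `|s|%N%:Z.
  have -> : `|s|%N%:Z = s by lia.
  by rewrite {1}kE mulrDr addrC mulrA -PoszM mulnC -nE.
by rewrite {1}qk addrK Hn -qk.
Qed.

Theorem periodic_in_subalgebra f : dadj q%:Z f = f -> R f.
Proof.
have q1 : (1 < q)%N.
  by rewrite /q -{1}(expn0 p) ltn_exp2l ?prime_gt1// logn_gt0 mem_primes p_pr n_gt0.
have [h [Rh h1 hq hfix]] := exists_ceil.
exact: (stairs_generate_periodic sR q1 (ceil_generates_stairs sR q1 Rh h1 hq hfix)).
Qed.

End Stabilizer.

Definition distributive_lattice d (L : latticeType d) := forall x y z : L,
  Order.meet x (Order.join y z) = Order.join (Order.meet x y) (Order.meet x z).

(** * The action on translates of a prime filter *)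
Section PrimeFilter.
Context {d : Order.disp_t} {L : latticeType d} (distL : distributive_lattice L).
Implicit Types (a b x y z : L) (S : set L).
Local Open Scope classical_set_scope.

Record prime_filter (P : set L) : Prop := PrimeFilter {
  pf_up : forall x y, x <= y -> P x -> P y;
  pf_meet : forall x y, P x -> P y -> P (Order.meet x y);
  pf_join : forall x y, P (Order.join x y) -> P x \/ P y
}.

(** The empty set is allowed, so that the union of an empty chain qualifies. *)
Let pre_filter a b S := [/\ forall x y, x <= y -> S x -> S y,
  forall x y, S x -> S y -> S (Order.meet x y), S `<=` [set x | S a] & ~ S b].

Lemma prime_filter_separation a b : ~~ (a <= b) ->
  exists P, [/\ prime_filter P, P a & ~ P b].
Proof.
move=> nab; have [] := @Zorn_bigcup L (pre_filter a b).
  move=> F FP tot; split.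
  - by move=> x y xy [S FS Sx]; exists S => //; have [up _ _ _] := FP _ FS; exact: up Sx.
  - move=> x y [S FS Sx] [S' FS' Sy].
    have [SS|SS] := tot _ _ FS FS'.
      by exists S' => //; have [_ I _ _] := FP _ FS'; apply: I => //; exact: SS.
    by exists S => //; have [_ I _ _] := FP _ FS; apply: I => //; exact: SS.
  - move=> x [S FS Sx]; exists S => //; have [_ _ aS _] := FP _ FS; exact: aS Sx.
  - by move=> [S FS Sb]; have [_ _ _] := FP _ FS.
move=> P [[up I aP bP] Pmax].
have {}Pmax Q : P `<=` Q -> pre_filter a b Q -> Q `<=` P.
  by move=> PQ gQ; apply: contrapT => QP; exact: Pmax gQ.
have Pa : P a.
  have ga : pre_filter a b [set z | a <= z].
    split=> [x y xy /le_trans|x y /= ax ay|x _|] /=.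
    - exact.
    - by rewrite lexI ax.
    - exact: lexx.
    - exact/negP.
  apply: contrapT => nPa; have P0 : P `<=` [set z | a <= z].
    by move=> x /aP.
  by apply: nPa; apply: (Pmax _ P0 ga) => /=.
exists P; split=> //; split=> // x y Pxy; apply: contrapT => /not_orP[nx ny].
have ext z : ~ P z -> exists2 m, P m & Order.meet m z <= b.
  move=> nz; pose Q := [set t | exists2 m, P m & Order.meet m z <= t].
  apply: contrapT => nb; apply: nz.
  have PQ : P `<=` Q by move=> t Pt; exists t => //; exact: leIl.
  have gQ : pre_filter a b Q.
    split=> //.
    - by move=> s t st [m Pm ms]; exists m => //; exact: le_trans st.
    - move=> s t [m Pm ms] [m' Pm' mt]; exists (Order.meet m m'); first exact: I.
      rewrite lexI (le_trans _ ms) ?(le_trans _ mt)//.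
        by rewrite leI2// leIr.
      by rewrite leI2// leIl.
    - by move=> s _; exact: PQ.
  by apply: (Pmax _ PQ gQ); exists a => //; exact: leIr.
have [m Pm mx] := ext x nx; have [m' Pm' my] := ext y ny.
apply: bP; apply: up (I _ _ (I _ _ Pm Pm') Pxy).
rewrite distL leUx (le_trans _ mx) ?(le_trans _ my)//.
  by rewrite leI2// leIr.
by rewrite leI2// leIl.
Qed.

End PrimeFilter.

Section Translates.
Context {d : Order.disp_t} {A : lpregroupType d}.
Implicit Types (a b x y z : A) (P : set A).

(** Left multiplication by [z] has both adjoints: the left multiplications by
    [ladj z] and [radj z]. *)
Lemma lp_mulIl z x y : z * Order.meet x y = Order.meet (z * x) (z * y).
Proof.
apply/eqP; rewrite eq_le lexI !lp_mul2l ?leIl ?leIr//=.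
set r := Order.meet _ _.
rewrite -[leLHS]mul1g (le_trans (lp_mul2r _ _ _ (Mladj_ge1 z)))// -mulgA lp_mul2l//.
rewrite lexI; apply/andP; split; rewrite -[leRHS]mul1g.
  by rewrite (le_trans _ (lp_mul2r _ _ _ (ladjM_le1 z)))// -mulgA lp_mul2l// leIl.
by rewrite (le_trans _ (lp_mul2r _ _ _ (ladjM_le1 z)))// -mulgA lp_mul2l// leIr.
Qed.

Lemma lp_mulUl z x y : z * Order.join x y = Order.join (z * x) (z * y).
Proof.
apply/eqP; rewrite eq_le andbC leUx !lp_mul2l ?leUl ?leUr//=.
set r := Order.join (z * x) _.
rewrite -[leRHS]mul1g (le_trans _ (lp_mul2r _ _ _ (Mradj_le1 z)))// -mulgA lp_mul2l//.
rewrite leUx; apply/andP; split; rewrite -[leLHS]mul1g.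
  by rewrite (le_trans (lp_mul2r _ _ _ (radjM_ge1 z)))// -mulgA lp_mul2l// leUl.
by rewrite (le_trans (lp_mul2r _ _ _ (radjM_ge1 z)))// -mulgA lp_mul2l// leUr.
Qed.

Lemma lp_mulIr z x y : Order.meet x y * z = Order.meet (x * z) (y * z).
Proof.
apply: (can_inj ladjK); rewrite ladjM !ladjI !ladjM; exact: lp_mulUl.
Qed.

Lemma lp_mulUr z x y : Order.join x y * z = Order.join (x * z) (y * z).
Proof.
apply: (can_inj ladjK); rewrite ladjM !ladjU !ladjM; exact: lp_mulIl.
Qed.

(** Expanding [(x \/ y) * (a /\ b)] in the two possible orders gives
    [(xa /\ xb) \/ (ya /\ yb) = (xa \/ ya) /\ (xb \/ yb)]. *)
Lemma lp_exchange a b x y :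
  Order.meet (x * a) (y * b) <= Order.join (x * b) (y * a).
Proof.
have E : Order.join (Order.meet (x * a) (x * b)) (Order.meet (y * a) (y * b))
   = Order.meet (Order.join (x * a) (y * a)) (Order.join (x * b) (y * b)).
  by rewrite -!lp_mulUr -!lp_mulIl lp_mulUr.
apply: (@le_trans _ _ (Order.meet (Order.join (x * a) (y * a))
  (Order.join (x * b) (y * b)))).
  by rewrite leI2 ?leUl ?leUr.
by rewrite -E leU2 ?leIl ?leIr.
Qed.

Definition translate P a : set A := fun z => P (z * a).

(** Otherwise some [x * a] and [y * b] are in [P] while [x * b] and [y * a] are
    not, against [lp_exchange] and primeness. *)
Lemma translate_total P a b : prime_filter P ->
  (translate P a `<=` translate P b)%classic \/
  (translate P b `<=` translate P a)%classic.
Proof.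
move=> [up I J]; apply: contrapT => /not_orP[].
move=> /existsNP[x /not_implyP[xa xb]] /existsNP[y /not_implyP[yb ya]].
by have /J[] := up _ _ (lp_exchange a b x y) (I _ _ xa yb).
Qed.

End Translates.

Section Orbit.
Context {d : Order.disp_t} {A : lpregroupType d}.
Local Open Scope classical_set_scope.

(** Bundled, so that the order structure on [orbit P] can be inferred from [P]
    alone. *)
Record primeFilter := MkPF { pf_set :> set A; pf_prime : prime_filter pf_set }.

Record orbit (P : primeFilter) :=
  MkOrbit { orbit_val :> set A; orbitP : exists a, orbit_val = translate P a }.

Variable P : primeFilter.
Implicit Types s t : orbit P.

Lemma orbit_val_inj : injective (@orbit_val P).
Proof.
by move=> [s sP] [t tP] /= st; subst t; congr MkOrbit; exact: Prop_irrelevance.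
Qed.

HB.instance Definition _ := gen_eqMixin (orbit P).
HB.instance Definition _ := gen_choiceMixin (orbit P).

Definition orbit_le s t := `[< s `<=` t >].

Fact orbit_le_refl : reflexive orbit_le.
Proof. by move=> s; apply/asboolP. Qed.
Fact orbit_le_anti : antisymmetric orbit_le.
Proof.
by move=> s t /andP[/asboolP st /asboolP ts]; apply: orbit_val_inj; exact/seteqP.
Qed.
Fact orbit_le_trans : transitive orbit_le.
Proof.
by move=> t s r /asboolP st /asboolP tr; apply/asboolP; exact: subset_trans st tr.
Qed.
HB.instance Definition _ := Order.Le_isPOrder.Build lp_display (orbit P)
  orbit_le_refl orbit_le_anti orbit_le_trans.

Fact orbit_le_total : total (<=%O : rel (orbit P)).
Proof.
move=> s t; apply/orP; have [a sE] := orbitP s; have [b tE] := orbitP t.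
have := translate_total a b (pf_prime P); rewrite -sE -tE.
by case=> /asboolP; [left|right].
Qed.
HB.instance Definition _ :=
  Order.POrder_isTotal.Build lp_display (orbit P) orbit_le_total.

Fact orbit_act_subproof a s : exists b, translate s a = translate P b.
Proof.
have [c sE] := orbitP s; exists (a * c).
by apply/funext => z; rewrite /translate sE /translate mulgA.
Qed.
Definition orbit_act a s : orbit P := MkOrbit (orbit_act_subproof a s).

Lemma orbit_leP s t : reflect (s `<=` t) (s <= t).
Proof. exact: asboolP. Qed.

Lemma orbit_chain_action : chain_action orbit_act.
Proof.
have sP s : prime_filter s.
  have [a ->] := orbitP s; have [up I J] := pf_prime P; rewrite /translate; split.
  - by move=> x y xy; apply: up; exact: lp_mul2r.
  - by move=> x y; rewrite lp_mulIr; exact: I.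
  - by move=> x y; rewrite lp_mulUr; exact: J.
split.
- by move=> w; apply: orbit_val_inj; apply/funext => z; rewrite /= /translate mulg1.
- by move=> a b w; apply: orbit_val_inj; apply/funext => z; rewrite /= /translate mulgA.
- by move=> a s t /orbit_leP st; apply/orbit_leP => z; exact: st.
- move=> a b w; apply: le_anti; apply/andP; split.
    rewrite le_min; apply/andP; split; apply/orbit_leP => z; apply: (pf_up (sP w));
    by rewrite lp_mulIl ?leIl ?leIr.
  case: (leP (orbit_act a w) (orbit_act b w)) => [/orbit_leP h|/ltW/orbit_leP h];
    apply/orbit_leP => z zw.
    by rewrite /= /translate lp_mulIl; apply: (pf_meet (sP w)) => //; exact: h.
  by rewrite /= /translate lp_mulIl; apply: (pf_meet (sP w)) => //; exact: h.
- move=> a b w; apply: le_anti; apply/andP; split.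
    case: (leP (orbit_act a w) (orbit_act b w)) => [/orbit_leP h|/ltW/orbit_leP h];
    apply/orbit_leP => z;
    by rewrite /= /translate lp_mulUl => /(pf_join (sP w))[] //; exact: h.
  rewrite ge_max; apply/andP; split; apply/orbit_leP => z; apply: (pf_up (sP w));
  by rewrite lp_mulUl ?leUl ?leUr.
Qed.

End Orbit.

Lemma chain_action_separation d (A : lpregroupType d) (x y : A) :
  distributive_lattice A -> x != y ->
  exists (T : orderType lp_display) (act : A -> T -> T) (w : T),
    chain_action act /\ act x w != act y w.
Proof.
move=> distA xy.
suff {xy} sep a b : ~~ (a <= b) -> exists (T : orderType lp_display)
    (act : A -> T -> T) (w : T), chain_action act /\ act a w != act b w.
  have [xley|/sep//] := boolP (x <= y).
  have [|T [act [w [h ne]]]] := sep y x; last by exists T, act, w; rewrite eq_sym.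
  by apply: contra xy => yx; rewrite eq_le xley.
move=> /(prime_filter_separation distA)[P [pP Pa Pb]].
pose Q := MkPF pP.
have w0 : exists c, (Q : set A) = translate Q c.
  by exists 1; apply/funext => z; rewrite /translate mulg1.
exists (orbit Q), (@orbit_act _ _ Q), (MkOrbit w0); split.
  exact: orbit_chain_action.
apply/eqP => /(congr1 (fun s => orbit_val s 1)); rewrite /= /translate !mul1g => e.
by apply: Pb; rewrite -e.
Qed.

(** * Functions realized on a block *)
Section Represents.
Context {d : Order.disp_t} {A : lpregroupType d} {d' : Order.disp_t}
  {T : orderType d'} {act : A -> T -> T} (act_chain : chain_action act).
Implicit Types (a b : A) (f g : FZ) (W Z Y : int -> T).

Definition represents a W Z f := forall i, act a (W i) = Z (f i).

Lemma represents_inj a W Z f g : block Z ->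
  represents a W Z f -> represents a W Z g -> f = g.
Proof.
by move=> bZ af ag; apply: FZ_ext => i; apply: (block_inj bZ); rewrite -af ag.
Qed.

Lemma represents_mul a b W Z Y f g :
  represents b W Z g -> represents a Z Y f -> represents (a * b) W Y (f * g).
Proof. by move=> bg af i; rewrite (actM act_chain) bg af. Qed.

Lemma represents_meet a b W Z f g : block Z ->
  represents a W Z f -> represents b W Z g ->
  represents (Order.meet a b) W Z (Order.meet f g).
Proof.
move=> bZ af bg i; rewrite (actI act_chain) af bg FZ_meetE.
by rewrite !minEle block_le//; case: ifP.
Qed.

Lemma represents_join a b W Z f g : block Z ->
  represents a W Z f -> represents b W Z g ->
  represents (Order.join a b) W Z (Order.join f g).
Proof.
move=> bZ af bg i; rewrite (actU act_chain) af bg FZ_joinE.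
by rewrite !maxEle block_le//; case: ifP.
Qed.

(** Adjoints are determined by the order, and a block is convex and unbounded
    for [f], so the adjoints of [act a] and of [f] agree on it. *)
Lemma represents_ladj a W Z f : block W -> block Z ->
  represents a W Z f -> represents (ladj a) Z W (ladj f).
Proof.
move=> bW bZ af i; apply/eqP; rewrite eq_le (act_ladj act_chain) af block_le//.
rewrite -FZ_ladjP lexx /=.
have /covers_succ_le <- : covers (W (ladj f i - 1)%R) (W (ladj f i)).
  by have := bW (ladj f i - 1)%R; rewrite subrK.
rewrite ltNge (act_ladj act_chain) af block_le// -FZ_ladjP; lia.
Qed.

Lemma represents_radj a W Z f : block W -> block Z ->
  represents a W Z f -> represents (radj a) Z W (radj f).
Proof.
move=> bW bZ af i; apply/eqP; rewrite eq_le andbC (act_radj act_chain) af block_le//.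
rewrite -FZ_radjP lexx /=.
have /covers_le_pred <- := bW (radj f i).
rewrite ltNge (act_radj act_chain) af block_le// -FZ_radjP; lia.
Qed.

Lemma represents_dadj (k : nat) a W Z f : block W -> block Z ->
  represents a W Z f -> represents (dadj k%:Z a) W Z (dadj k%:Z f).
Proof.
move=> bW bZ af; elim: k => [//|k IH].
by rewrite -addn1 PoszD !dadjS; do 2 apply: represents_ladj => //.
Qed.

Definition representable X f := exists a, represents a X X f.

Lemma representable_subalgebra X : block X -> subalgebra (representable X).
Proof.
move=> bX; split.
- by exists 1 => i; rewrite (act1 act_chain).
- by move=> f g [a af] [b bg]; exists (a * b); exact: represents_mul bg af.
- by move=> f g [a af] [b bg]; exists (Order.meet a b); exact: represents_meet.
- by move=> f g [a af] [b bg]; exists (Order.join a b); exact: represents_join.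
- by move=> f [a af]; exists (ladj a); exact: represents_ladj.
- by move=> f [a af]; exists (radj a); exact: represents_radj.
Qed.

Lemma represents_eval X (u : nat -> A) (v : nat -> FZ) t : block X ->
  (forall i, represents (u i) X X (v i)) ->
  represents (lpeval u t) X X (lpeval v t).
Proof.
move=> bX uv; elim: t => //=.
- by move=> s IHs t IHt; exact: represents_meet.
- by move=> s IHs t IHt; exact: represents_join.
- by move=> s IHs t IHt; exact: represents_mul IHt IHs.
- by move=> i; rewrite (act1 act_chain).
- by move=> t IH; exact: represents_ladj.
- by move=> t IH; exact: represents_radj.
Qed.

Lemma representable_satisfies X e : block X -> satisfies A e ->
  forall v : nat -> FZ, (forall i, representable X (v i)) -> lpeval v e.1 = lpeval v e.2.
Proof.
move=> bX Ae v /choice[u uv].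
have r1 := represents_eval e.1 bX uv; have r2 := represents_eval e.2 bX uv.
by rewrite Ae in r1; exact: represents_inj r1 r2.
Qed.

End Represents.

Lemma periodic_sub_eval q (v : nat -> FnZ q) t :
  periodic_val (lpeval v t) = lpeval (fun i => periodic_val (v i)) t.
Proof.
elim: t => //=.
- by move=> s <- t <-.
- by move=> s <- t <-.
- by move=> s <- t <-.
- by move=> t <-.
- by move=> t <-.
Qed.

Lemma FnZ_dadj q (f : FnZ q) : dadj q%:Z (periodic_val f) = periodic_val f.
Proof. by have /periodic_eltP := periodic_valP f. Qed.

(** The point of passing to a closure operator is that it acts from a block to
    the same block, whereas the given aperiodic element may act between two
    different ones. *)
Lemma exists_aperiodic_closure d (A : lpregroupType d) n p : distributive_lattice A ->
  n_periodic A n -> (0 < n)%N -> prime p -> (p %| n)%N -> ~ n_periodic A (n %/ p) ->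
  exists (T : orderType lp_display) (act : A -> T -> T) (X : int -> T) (g : FZ),
    [/\ chain_action act, block X, representable (act := act) X g, closure_elt g
     & dadj n%:Z g = g /\ dadj (n %/ p)%N%:Z g <> g].
Proof.
move=> distA nA n0 pp pn; set m := (n %/ p)%N => nmA.
have [x /eqP xm] : exists x : A, dadj m%:Z x <> x.
  apply: contrapT => /forallNP h; apply: nmA; apply/periodic_dadjP => x.
  exact: contrapT (h x).
have [T [act [w [actT ne]]]] := chain_action_separation distA xm.
have [a aw] : exists a, act (dadj 1%R a) w != act a w.
  apply: contrapT => /forallNP h; move/negP: ne; apply.
  elim: m {nmA xm} => [//|k /eqP <-]; rewrite -addn1 PoszD dadjS.
  by apply/negPn/negP => /h.
have [W [i0 [bW Wi0]]] := block_of_shift actT n0 nA aw.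
have [Z [f [bZ xf]]] := block_transport actT x n0 nA bW.
have fm : dadj m%:Z f <> f.
  move=> e; have := represents_dadj actT m bW bZ xf; rewrite e => /(_ i0).
  by rewrite -xf Wi0 => /eqP; apply/negP.
have xn : dadj n%:Z x = x by exact: (proj1 (periodic_dadjP n) nA x).
have fn : dadj n%:Z f = f.
  by have := represents_dadj actT n bW bZ xf; rewrite xn => h; exact: represents_inj h xf.
have nE : n = (p * m)%N by rewrite mulnC divnK.
have p0 := prime_gt0 pp.
have lxf := represents_ladj actT bW bZ xf.
have [im|im] := pselect (dadj m%:Z (f * ladj f) = f * ladj f); last first.
  exists T, act, Z, (f * ladj f); split=> //.
  - by exists (x * ladj x); exact: represents_mul xf.
  - exact: mul_ladj_closure.
  - by split=> //; rewrite dadjM dadj_ladj fn.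
have ker : dadj m%:Z (ladj f * f) <> ladj f * f.
  by move=> ker; apply: fm; apply: (shift_eq_of_kernel_image p0) => //; rewrite -nE.
exists T, act, W, (ladj f * ladj (ladj f)); split=> //.
- exists (ladj x * ladj (ladj x)); apply: (represents_mul actT _ lxf).
  exact: (represents_ladj actT bZ bW lxf).
- exact: mul_ladj_closure.
- split; first by rewrite dadjM !dadj_ladj fn.
  by rewrite -ladjM dadj_ladj => /(can_inj ladjK)/ker.
Qed.

(** Valuations in [FnZ q] lift to valuations in [A] along the realization on the
    block. *)
Lemma FnZ_satisfies d (A : lpregroupType d) n p e : distributive_lattice A ->
  n_periodic A n -> (0 < n)%N -> prime p -> (p %| n)%N -> ~ n_periodic A (n %/ p) ->
  satisfies A e -> satisfies (FnZ (p ^ logn p n)) e.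
Proof.
move=> distA nA n0 pp pn nmA Ae v.
have [T [act [X [g [actT bX Rg g_cl [gn gm]]]]]] :=
  exists_aperiodic_closure distA nA n0 pp pn nmA.
apply: val_inj; rewrite /= !periodic_sub_eval.
apply: (representable_satisfies actT bX Ae) => i.
apply: (periodic_in_subalgebra (representable_subalgebra actT bX) n0 pp pn Rg gn
  g_cl gm).
exact: FnZ_dadj.
Qed.

Lemma FnZ_periodic_dvd q m : (0 < q)%N -> n_periodic (FnZ q) m -> (q %| m)%N.
Proof.
move=> q0 qm.
pose f (x : int) : int := (q%:Z * (x %/ q)%Z)%R.
have ff : f \in fz.
  apply/fzP; split=> [x y xy|y|y].
  - have /andP[] := divz_bounds x q0; have /andP[] := divz_bounds y q0.
    rewrite /f; set s := (x %/ q)%Z; set t := (y %/ q)%Z => y1 y2 x1 x2.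
    rewrite ler_pM2l//; suff : (s < t + 1)%R by lia.
    by rewrite -(ltr_pM2l (_ : 0 < q%:Z)%R)//; lia.
  - exists (y + q%:Z)%R; have /andP[] := divz_bounds (y + q%:Z)%R q0; rewrite /f; lia.
  - by exists y; have /andP[] := divz_bounds y q0.
pose F := MkFZ ff.
have Fq : dadj q%:Z F = F.
  apply: FZ_ext => x; rewrite FZ_dadjE /= /f.
  by have := divzMDr (x - q%:Z)%R 1 q0; rewrite mulr1 subrK => ->; lia.
have Fp : F \in periodic_elt q by apply/periodic_eltP.
pose G : FnZ q := PeriodicSub Fp.
have iterE k : periodic_val (iter k ladj G) = iter k ladj F.
  by elim: k => //= k <-.
have := (periodic_dadjP m).1 qm G => /(congr1 (@periodic_val _ _ _)).
rewrite /dadj iterE /= => /(congr1 (fun h : FZ => h (m%:Z)%R)).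
rewrite -[iter _ _ _]/(dadj m%:Z F) FZ_dadjE subrr /= /f div0z mulr0 add0r => mE.
by have : (q%:Z %| m%:Z)%Z by rewrite mE dvdz_mulr.
Qed.

(** * The interval of properly periodic varieties *)
Section Varieties.
Local Open Scope classical_set_scope.

Lemma generated_variety_sub (K W : set lpregroup) : variety W ->
  K `<=` W <-> generated_variety K `<=` W.
Proof.
move=> vW; split=> [KW A AK|KW A KA]; first exact: AK.
by apply: KW => V [_ KV]; exact: KV.
Qed.

Lemma variety_join_sub (V W : set lpregroup) (S : set (set lpregroup)) :
  subvarieties V W -> (forall X, S X -> X `<=` W) <-> variety_join V S `<=` W.
Proof.
move=> vW; split=> [SW A AS|SW X SX A XA]; first exact: AS.
by apply: SW => W' [_ SW']; exact: SW' XA.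
Qed.

Lemma FnZ_join_sub W (I : set nat) : subvarieties DLP W ->
  variety_join DLP [set generated_variety [set FnZ q] | q in I] `<=` W <->
  forall q, I q -> W (FnZ q).
Proof.
move=> sW; rewrite -variety_join_sub//; split=> [h q Iq|h _ [q Iq <-]].
  have := h (generated_variety [set FnZ q]); rewrite -(generated_variety_sub _ sW.1).
  by apply=> //; exists q.
by rewrite -(generated_variety_sub _ sW.1) => _ ->; exact: h.
Qed.

Lemma FnZ_in_properly_periodic n W p : (0 < n)%N -> subvarieties DLP W ->
  properly_periodic n W -> p \in primes n -> W (FnZ (p ^ logn p n)).
Proof.
move=> n0 [[E WE] WDLP] [nW pW]; rewrite mem_primes => /and3P[pp _ pn].
have m_bounds : (0 < n %/ p < n)%N.
  by rewrite divn_gt0 ?prime_gt0// dvdn_leq//= ltn_Pdiv ?prime_gt1.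
have [A [WA nA]] : exists A : lpregroup, W A /\ ~ n_periodic A (n %/ p).
  apply: contrapT => /forallNP h; apply: (pW _ m_bounds) => A WA.
  by apply: contrapT => nA; apply: (h A).
rewrite WE => e Ee; apply: (@FnZ_satisfies _ A) => //.
- exact: WDLP.
- exact: nW.
- by move: WA; rewrite WE; apply.
Qed.

Lemma maximal_prime_powersP n q : maximal_prime_powers n q <->
  exists2 p, p \in primes n & q = (p ^ logn p n)%N.
Proof.
rewrite /maximal_prime_powers prime_decompE; split=> [[f /= /mapP[p pn ->] <-]|[p pn ->]].
  by exists p.
by exists (p, logn p n) => //=; apply/mapP; exists p.
Qed.

Lemma maximal_prime_powers_dvd n m : (0 < n)%N ->
  (forall q, maximal_prime_powers n q -> (q %| m)%N) -> (n %| m)%N.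
Proof.
move=> n0 h; apply/dvdn_partP => // p pn; rewrite p_part.
by apply: h; apply/maximal_prime_powersP; exists p.
Qed.

Lemma properly_periodic_intervalE n : (0 < n)%N ->
  [set W | subvarieties DLP W /\ properly_periodic n W]
  = variety_interval DLP
      (variety_join DLP
         [set generated_variety [set FnZ q] | q in maximal_prime_powers n])
      (LP n).
Proof.
move=> n0; apply/seteqP; split=> W.
  move=> [sW pW]; split=> //; last exact: pW.1.
  apply/FnZ_join_sub => // q /maximal_prime_powersP[p pn ->].
  exact: FnZ_in_properly_periodic.
move=> [sW /(FnZ_join_sub _ sW) FW WLP]; split=> //; split=> // m /andP[m0 mn] mW.
have : (n %| m)%N.
  apply: maximal_prime_powers_dvd => // q qn.
  apply: FnZ_periodic_dvd; last exact/mW/FW.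
  have /maximal_prime_powersP[p pn ->] := qn.
  by move: pn; rewrite mem_primes expn_gt0 => /and3P[/prime_gt0 ->].
by move=> /(dvdn_leq m0); rewrite leqNgt mn.
Qed.

Lemma prime_power_intervalE n :
  (exists p k : nat, [/\ prime p, (0 < k)%N & n = (p ^ k)%N]) ->
   variety_interval DLP
      (variety_join DLP
         [set generated_variety [set FnZ q] | q in maximal_prime_powers n])
      (LP n)
   = variety_interval DLP (generated_variety [set FnZ n]) (LP n).
Proof.
move=> [p [k [pp k0 nE]]].
have mpp q : maximal_prime_powers n q <-> q = n.
  rewrite maximal_prime_powersP nE primesX// primes_prime//; split=> [[p']|->].
    by rewrite inE => /eqP -> ->; rewrite pfactorK.
  by exists p; rewrite ?inE ?pfactorK.
suff sub W : subvarieties DLP W ->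
    variety_join DLP [set generated_variety [set FnZ q] | q in maximal_prime_powers n] `<=` W
    <-> generated_variety [set FnZ n] `<=` W.
  by apply/seteqP; split=> W [sW /(sub _ sW)].
move=> sW; rewrite FnZ_join_sub// -(generated_variety_sub _ sW.1).
split=> [h _ ->|h q /mpp ->]; last exact: h.
by apply: h; exact/mpp.
Qed.

End Varieties.

Local Open Scope classical_set_scope.

Theorem corollary6p20 (n : nat) (n_gt0 : (0 < n)%N) :
  [set W | subvarieties DLP W /\ properly_periodic n W]
  = variety_interval DLP
      (variety_join DLP
         [set generated_variety [set FnZ q] | q in maximal_prime_powers n])
      (LP n)
  /\
  ((exists p k : nat, [/\ prime p, (0 < k)%N & n = (p ^ k)%N]) ->
   variety_interval DLP
      (variety_join DLP
         [set generated_variety [set FnZ q] | q in maximal_prime_powers n])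
      (LP n)
   = variety_interval DLP (generated_variety [set FnZ n]) (LP n)).
Proof.
by split; [exact: properly_periodic_intervalE|exact: prime_power_intervalE].
Qed.
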